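(* Let $(\mathcal{M},\tau)$ be a non-commutative probability space and let $\{X_i\}_{i\in\mathbb{N}}\subset\mathcal{M}$ be a sequence of Boolean independent and identically distributed self-adjoint random variables with symmetric law $\mu$. Define $$S_n:=\frac{X_1+\cdots+X_n}{\sqrt{n}}.$$ Then, for any integers $n\ge m\ge 1$, we have $$\Psi(S_n)\le\Psi(S_m),$$ with equality if and only if $X_1$ has law $\frac12\delta_{-a}+\frac12\delta_a$ for some $a\ne0$.
   Context: A non-commutative probability space $(\mathcal{M},\tau)$ is a von Neumann algebra $\mathcal{M}$ with a nondegenerate normal state $\tau$, not necessarily faithful. For self-adjoint $A\in\mathcal{M}$, the law of $A$ is the unique probability measure $\mu$ on $\mathbb{R}$ with $\tau(A^k)=\int x^k\,d\mu(x)$ for all $k\in\mathbb{N}$. A family of self-adjoint elements $(X_i)$ is Boolean independent if $\tau(X_{i_1}^{k_1}X_{i_2}^{k_2}\cdots X_{i_p}^{k_p})=\tau(X_{i_1}^{k_1})\tau(X_{i_2}^{k_2})\cdots\tau(X_{i_p}^{k_p})$ for all $p\ge1$, all $k_1,\ldots,k_p\ge1$ and all indices with $i_1\ne i_2,\ i_2\ne i_3,\ldots,i_{p-1}\ne i_p$. Sums of Boolean independent variables with symmetric laws have symmetric laws. For a self-adjoint $X$ with symmetric law $\mu$, the Boolean Fisher information is $\Psi(X)=\iint\frac{\log x^2-\log y^2}{x^2-y^2}\,d\mu(x)\,d\mu(y)\in(0,+\infty]$, where the integrand is understood with its continuous extension on the diagonal $x^2=y^2$.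
   Formalization: The ''only if'' half of the equality case is stated only for n>m with Ψ(S_m)<+∞, because equality is trivial for n=m and also holds as +∞=+∞, e.g. when X_i=0; the inequality and the ''if'' half are stated for all n≥m≥1. *)

(* Defs.v *)
From HB Require Import structures.
From mathcomp Require Import all_boot all_order all_algebra.
From mathcomp Require Import sesquilinear complex.
From mathcomp Require Import all_classical all_reals all_analysis.

Set Implicit Arguments.
Unset Strict Implicit.
Unset Printing Implicit Defensive.

Import Order.TTheory GRing.Theory Num.Theory.
Import numFieldNormedType.Exports.

Local Open Scope classical_set_scope.
Local Open Scope ring_scope.
Local Open Scope complex_scope.

Section VonNeumannAlgebra.
Variables (R : realType) (H : completeNormedModType R[i]).
Variable dot : {dot H for Num.conj}.

(* [dot] is linear in its first argument and conjugate-linear in the second.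
   Completeness is that of the norm, so this makes [H] a Hilbert space. *)
Definition hilbert : Prop := forall x : H, `|x| ^+ 2 = dot x x.

Definition bounded_operator (A : H -> H) : Prop :=
  linear A /\ exists C : R[i], forall x, `|A x| <= C * `|x|.

Definition is_adjoint (A B : H -> H) : Prop :=
  forall x y, dot (A x) y = dot x (B y).

Definition selfadjoint (A : H -> H) : Prop := is_adjoint A A.

(* The order of the complex numbers makes [dot (A x) x] real, so that a
   positive operator is self-adjoint. *)
Definition pos_operator (A : H -> H) : Prop := forall x, 0 <= dot (A x) x.

Definition le_operator (A B : H -> H) : Prop := pos_operator (B - A).

Definition commutant (S : set (H -> H)) : set (H -> H) :=
  [set B | bounded_operator B /\ forall A, S A -> A \o B = B \o A].

Definition von_neumann_algebra (M : set (H -> H)) : Prop :=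
  [/\ M `<=` bounded_operator,
      forall A, M A -> exists2 B, M B & is_adjoint A B
    & commutant (commutant M) = M].

(* Least upper bound among the self-adjoint elements of [M]. *)
Definition operator_lub (M D : set (H -> H)) (A : H -> H) : Prop :=
  [/\ M A, selfadjoint A, forall B, D B -> le_operator B A
    & forall C, M C -> selfadjoint C ->
        (forall B, D B -> le_operator B C) -> le_operator A C].

Definition directed (D : set (H -> H)) : Prop :=
  D !=set0 /\ forall A B, D A -> D B ->
    exists2 C, D C & le_operator A C /\ le_operator B C.

(* The values of [tau] outside [M] are irrelevant. *)
Definition state (M : set (H -> H)) (tau : (H -> H) -> R[i]) : Prop :=
  [/\ forall (c : R[i]) A B, M A -> M B -> tau (c *: A + B) = c * tau A + tau B,
      forall A, M A -> pos_operator A -> 0 <= tau A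
    & tau idfun = 1].

Definition normal (M : set (H -> H)) (tau : (H -> H) -> R[i]) : Prop :=
  forall (D : set (H -> H)) (A : H -> H),
    D `<=` M `&` selfadjoint -> directed D -> operator_lub M D A ->
    isLub (tau @` D) (tau A).

(* Equivalently, the GNS representation of [tau] is faithful; this is weaker
   than [tau] being faithful. *)
Definition nondegenerate (M : set (H -> H)) (tau : (H -> H) -> R[i]) : Prop :=
  forall A, M A ->
    (forall B C, M B -> M C -> tau (B \o A \o C) = 0) -> A = 0.

Definition nc_probability_space (M : set (H -> H)) (tau : (H -> H) -> R[i]) :
    Prop :=
  [/\ hilbert, von_neumann_algebra M, state M tau, normal M tau
    & nondegenerate M tau].

End VonNeumannAlgebra.

Section Laws.
Variables (R : realType) (H : completeNormedModType R[i]).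
Variable tau : (H -> H) -> R[i].

Definition has_law (A : H -> H) (mu : probability (measurableTypeR R) R) :
    Prop :=
  forall k : nat,
    mu.-integrable setT (fun x : R => (x ^+ k)%:E) /\
    tau (iter k A) = (\int[mu]_x (x ^+ k))%:C.

(* The law of [A]; it exists and is unique when [A] is a self-adjoint random
   variable. The value is junk for an [A] without law. *)
Definition law (A : H -> H) : probability (measurableTypeR R) R :=
  if pselect (exists mu, has_law A mu) is left h then projT1 (cid h)
  else \d_(0 : measurableTypeR R).

Definition boolean_independent (I : eqType) (X : I -> H -> H) : Prop :=
  forall s : seq (I * nat),
    s != [::] -> all (fun p => 0 < p.2)%N s ->
    sorted (fun p q => p.1 != q.1) s ->
    tau (\big[comp/idfun]_(p <- s) iter p.2 (X p.1)) =
    \prod_(p <- s) tau (iter p.2 (X p.1)).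

End Laws.

Section Fisher.
Variable R : realType.

Definition symmetric_law (mu : probability (measurableTypeR R) R) : Prop :=
  forall A : set R, measurable A -> mu ((fun x => - x) @^-1` A) = mu A.

Local Open Scope ereal_scope.

Definition two_point (a : R) : set (measurableTypeR R) -> \bar R :=
  measure_add (mscale (2^-1)%:nng%R \d_((- a)%R : measurableTypeR R))
              (mscale (2^-1)%:nng%R \d_(a : measurableTypeR R)).

HB.instance Definition _ a := Measure.on (two_point a).

Lemma two_point_setT a : two_point a setT = 1.
Proof.
rewrite /two_point measure_addE /= /mscale /=.
by rewrite !diracT !mule1 -EFinD [in RHS](splitr 1%R) !mul1r.
Qed.

HB.instance Definition _ a :=
  Measure_isProbability.Build _ _ _ (two_point a) (two_point_setT a).

(* [lne 0 = -oo] and [0^-1 = +oo] in the extended reals, so that the value is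
   [+oo] when [x] or [y] is 0. On [x ^+ 2 = y ^+ 2], the continuous extension
   is the derivative of the logarithm. *)
Definition fisher_kernel (x y : R) : \bar R :=
  if (x ^+ 2 == y ^+ 2)%R then ((x ^+ 2)%:E)^-1
  else (lne (x ^+ 2)%:E - lne (y ^+ 2)%:E) / (x ^+ 2 - y ^+ 2)%:E.

Definition boolean_fisher_information (H : completeNormedModType R[i])
    (tau : (H -> H) -> R[i]) (A : H -> H) : \bar R :=
  \int[law tau A]_x \int[law tau A]_y fisher_kernel x y.

End Fisher.

(* Main.v *)
Require Import Defs.
From HB Require Import structures.
From mathcomp Require Import all_boot all_order all_algebra.
From mathcomp Require Import sesquilinear complex.
From mathcomp Require Import all_classical all_reals all_analysis.
From mathcomp Require Import measurable_realfun ring lra zify.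

(* Write [g t] for the integral of [1 / (x^2 + t)] against a symmetric law.
   Since [(ln x^2 - ln y^2) / (x^2 - y^2)] is the integral over [t > 0] of
   [1 / ((x^2 + t) (y^2 + t))], Tonelli turns the Fisher information into the
   integral of [g t ^ 2] over [t > 0]. Boolean independence makes [1 / G(z) - z]
   additive; at [z = i sqrt t] this says that the transform of the law of [S_n]
   is [g_n t = (t + c (n t))^-1], where [c u = 1 / g u - u] comes from the law
   of [X_0]. Jensen's inequality shows that [c] is nondecreasing, so that [g_n]
   decreases with [n]; [c] takes the same value at two distinct points only if
   [x^2] is almost surely constant.

   The law of [S_n] exists because its moments, which are computed from those
   of [X_0], form a bounded positive functional on polynomials. *)

Set Implicit Arguments.
Unset Strict Implicit.
Unset Printing Implicit Defensive.
Import Order.TTheory GRing.Theory Num.Theory.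
Import numFieldNormedType.Exports.
Local Open Scope classical_set_scope.
Local Open Scope ring_scope.

(** * Moments of Boolean sums *)

(** Boolean independence yields only the moments of [S_n], and [1 / (x^2 + t)] is not a polynomial.
    Its integral is therefore reached through partial sums of a geometric series in
    [(C - 'X^2) / (C + t)], where [C] bounds the square of [S_n] at the level of moments. The
    remainder has to be small twice: against the law of [S_n], and, after the linear map [btrans],
    against the law of a single variable. Both estimates rest on one inequality. In the algebraic
    model of the Boolean sum, the square of [P] has moment [n E(Q^2) - (n-1) E(Q)^2] with
    [Q = btrans P], which is at least [E(Q^2)]. It gives positivity, enters the boundedness needed
    for the existence of the law, and carries errors from the sum back to one variable. The argument
    [n t] of [c] comes from the normalization: [X_0 / sqrt n] contributes [c (n t) / n], and [n]
    copies add up. *)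

Lemma poly_span (R : nzRingType) (V : lmodType R) (F G : {linear {poly R} -> V}) :
  (forall k, F 'X^k = G 'X^k) -> F =1 G.
Proof.
move=> FG P; rewrite -[P]coefK poly_def !raddf_sum/=.
by apply: eq_bigr => k _; rewrite !linearZ/= FG.
Qed.

Lemma scalarCM (R : comNzRingType) (F : {scalar {poly R}}) c P :
  F (c%:P * P) = c * F P.
Proof. by rewrite mul_polyC; exact: linearZ. Qed.

Section BooleanPower.
Variables (R : realFieldType) (E : {scalar {poly R}}) (n : nat).

(* Let the [X_i], [i < n], be Boolean independent with the same moments
   [E 'X^k], and let [S] be their sum. Then [tau (S^k X_i^j)] is
   [E ('X^j * bpoly k)] for [0 < j]: the last run of letters [X_i] in a word of
   [S^k] merges with [X_i^j]. The law of [S] has the moments [bmoment 'X^k]. *)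
Fixpoint bpoly (k : nat) : {poly R} :=
  if k is k'.+1 then
    'X * bpoly k' + (n.-1%:R * E ('X * bpoly k'))%:P
  else 1.

(** The linear extension of [bpoly]: for [0 < j], [E ('X^j * btrans P)] stands for
    [tau (P(S) X_i^j)]. *)
Definition btrans (P : {poly R}) : {poly R} := \sum_(k < size P) P`_k *: bpoly k.

Lemma btransE m (P : {poly R}) : (size P <= m)%N ->
  btrans P = \sum_(k < m) P`_k *: bpoly k.
Proof.
move=> sPm; rewrite /btrans (big_ord_widen m (fun k => P`_k *: bpoly k))//.
rewrite big_mkcond/=; apply: eq_bigr => k _; case: ltnP => // Pk.
by rewrite nth_default// scale0r.
Qed.

Lemma btrans_linear : linear btrans.
Proof.
move=> a P Q; pose m := maxn (size P) (size Q).
rewrite (@btransE m (a *: P + Q)) ?(@btransE m P) ?(@btransE m Q) ?leq_maxl ?leq_maxr//.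
  rewrite scaler_sumr -big_split/=; apply: eq_bigr => k _.
  by rewrite coefD coefZ scalerDl scalerA.
rewrite (leq_trans (size_polyD _ _))// geq_max leq_maxr andbT.
by rewrite (leq_trans (size_scale_leq _ _))// leq_maxl.
Qed.

HB.instance Definition _ :=
  GRing.isLinear.Build R {poly R} {poly R} _ btrans btrans_linear.

Lemma btransXn k : btrans 'X^k = bpoly k.
Proof.
rewrite /btrans size_polyXn big_ord_recr/= coefXn eqxx scale1r big1 ?add0r// => i _.
by rewrite coefXn ltn_eqF// scale0r.
Qed.

Lemma btrans1 : btrans 1 = 1.
Proof. by rewrite -(expr0 'X) btransXn. Qed.

Hypothesis E1 : E 1 = 1.

Lemma scalar_polyC c : E c%:P = c.
Proof. by rewrite -[c%:P]mulr1 mul_polyC linearZ/= E1 mulr1. Qed.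

Lemma btransXM P :
  btrans ('X * P) = 'X * btrans P + (n.-1%:R * E ('X * btrans P))%:P.
Proof.
rewrite -[P]coefK poly_def mulr_sumr !raddf_sum/= mulr_sumr raddf_sum/=.
rewrite mulr_sumr rmorph_sum -big_split/=; apply: eq_bigr => k _.
rewrite -scalerAr -exprS !linearZ/= !btransXn -scalerAr linearZ/= mulrCA.
by rewrite scalerDr; congr (_ + _); rewrite -mul_polyC -polyCM.
Qed.

Lemma btransCM c P : btrans (c%:P * P) = c%:P * btrans P.
Proof. by rewrite !mul_polyC linearZ. Qed.

Definition bmoment P := E (btrans P).

Lemma bmoment_linear : scalar bmoment.
Proof. by move=> a P Q; rewrite /bmoment !linearP. Qed.

HB.instance Definition _ :=
  GRing.isLinear.Build R {poly R} R _ bmoment bmoment_linear.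

Lemma bmoment1 : bmoment 1 = 1.
Proof. by rewrite /bmoment btrans1. Qed.

Hypothesis n0 : (0 < n)%N.

Lemma bmomentXM P : bmoment ('X * P) = n%:R * E ('X * btrans P).
Proof.
rewrite /bmoment btransXM linearD/= scalar_polyC -[in RHS](prednK n0) -[n.-1.+1]addn1.
by rewrite natrD mulrDl mul1r addrC.
Qed.

(* [B(P, Q)] below makes multiplication by 'X symmetric and restricts to
   [bmoment] for [P = 1]. *)
Lemma bmomentM P Q : bmoment (P * Q) =
  n%:R * E (btrans P * btrans Q) - n.-1%:R * (bmoment P * bmoment Q).
Proof.
pose B P Q := n%:R * E (btrans P * btrans Q) - n.-1%:R * (bmoment P * bmoment Q).
have nE : n%:R = n.-1%:R + 1 :> R by rewrite -[in LHS](prednK n0) -natr1.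
rewrite -/(B P Q); have BX P' Q' : B ('X * P') Q' = B P' ('X * Q').
  rewrite /B !bmomentXM !btransXM -/(bmoment P') -/(bmoment Q').
  rewrite mulrDl mulrDr !raddfD/= [btrans P' * _%:P]mulrC !scalarCM -/(bmoment P') -/(bmoment Q').
  rewrite [btrans P' * _]mulrCA -['X * _ * _]mulrA !nE; ring.
have B1 Q' : B 1 Q' = bmoment Q'.
  rewrite /B btrans1 mul1r bmoment1 mul1r -/(bmoment Q') nE; ring.
have BXn k Q' : B 'X^k Q' = bmoment ('X^k * Q').
  elim: k Q' => [|k ih] Q'; first by rewrite expr0 B1 mul1r.
  by rewrite exprS BX ih mulrA [_ * 'X]mulrC.
have EZ a p : E (a *: p) = a * E p by exact: linearZ.
have bmZ a p : bmoment (a *: p) = a * bmoment p by exact: linearZ.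
have trZ a p : btrans (a *: p) = a *: btrans p by exact: linearZ.
have lin1 : scalar (fun p => bmoment (p * Q)).
  by move=> a p q /=; rewrite mulrDl -scalerAl raddfD/= bmZ.
have lin2 : scalar (fun p => B p Q).
  move=> a p q; rewrite /B !raddfD/= mulrDl raddfD/= trZ bmZ -scalerAl EZ.
  by ring.
pose F1 : {scalar {poly R}} := HB.pack (fun p => bmoment (p * Q))
  (GRing.isLinear.Build _ _ _ _ _ lin1).
pose F2 : {scalar {poly R}} := HB.pack (fun p => B p Q)
  (GRing.isLinear.Build _ _ _ _ _ lin2).
exact: (poly_span (F := F1) (G := F2) (fun k => esym (BXn k Q))).
Qed.

Hypothesis E_ge0 : forall P : {poly R}, 0 <= E (P ^+ 2).

Lemma scalar_sqr_le P : E P ^+ 2 <= E (P ^+ 2).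
Proof.
have := E_ge0 (P - (E P)%:P).
rewrite sqrrB linearD linearB/= -mulr_natr [_ * _%:P]mulrC -mulrA -polyC_exp scalar_polyC.
rewrite mul_polyC linearZ/= -(natr1 1) mulrDr mulr1 linearD/=; nra.
Qed.

(** With [Q = btrans P], the gap is [n.-1] times the variance of [Q] under [E]. *)
Lemma bmoment_sqr_ge P : E (btrans P ^+ 2) <= bmoment (P ^+ 2).
Proof.
rewrite expr2 bmomentM -!expr2 -/(bmoment P).
have := scalar_sqr_le (btrans P); rewrite -/(bmoment P).
rewrite -[in n%:R](prednK n0) -natr1 mulrDl mul1r => h.
have := ler0n R n.-1; nra.
Qed.

Lemma bmoment_sqr_ge0 P : 0 <= bmoment (P ^+ 2).
Proof. exact: le_trans (E_ge0 _) (bmoment_sqr_ge P). Qed.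

(** The moment form of [|S| <= n |X|]. With [Y = 'X * btrans P], the left side is
    [n E(Y^2) + n (n-1) E(Y)^2], hence at most [n^2 E(Y^2)]. *)
Lemma bmoment_bounded K : (forall P, E ('X^2 * P ^+ 2) <= K * E (P ^+ 2)) ->
  0 <= K -> forall P, bmoment ('X^2 * P ^+ 2) <= n%:R ^+ 2 * K * bmoment (P ^+ 2).
Proof.
move=> EK K0 P; rewrite -exprMn.
have : bmoment (('X * P) ^+ 2) <= n%:R ^+ 2 * E (('X * btrans P) ^+ 2).
  rewrite expr2 bmomentM -!expr2 bmomentXM btransXM.
  set Y := 'X * btrans P; set e := E Y.
  have := scalar_sqr_le Y; rewrite -/e => eY.
  rewrite sqrrD !linearD/= -polyC_exp scalar_polyC [Y * _]mulrC mul_polyC linearZ/= -/e.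
  have nE : n%:R = n.-1%:R + 1 :> R by rewrite -[in LHS](prednK n0) -natr1.
  rewrite nE; have := ler0n R n.-1; set a := n.-1%:R => a0.
  rewrite -subr_ge0 [leRHS](_ : _ = a * (a + 1) * (E (Y ^+ 2) - e ^+ 2)); last by ring.
  by rewrite mulr_ge0 ?subr_ge0// mulr_ge0// addr_ge0.
move=> /le_trans; apply; rewrite -mulrA ler_wpM2l ?sqr_ge0//.
by rewrite exprMn (le_trans (EK _))// ler_wpM2l// bmoment_sqr_ge.
Qed.

End BooleanPower.
(* [A] plays the role of [P |-> E (P / ('X^2 + t))] and [Phi] that of
   [P |-> tau (P(S) U)] for an element [U] with [(S^2 + t) U = t] weakly. *)
Lemma bmoment_resolvent (R : realFieldType) (E A : {scalar {poly R}}) (n : nat) (t : R)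
    (P : {poly R}) : (0 < n)%N ->
  E 1 = 1 -> (forall q, A ('X^2 * q) + t * A q = E q) -> A 'X = 0 ->
  1 + n.-1%:R * (1 - t * A 1) != 0 ->
  let Phi P := bmoment E n P -
    n%:R / (1 + n.-1%:R * (1 - t * A 1)) * A ('X^2 * btrans E n P) in
  Phi (('X^2 + t%:P) * P) = t * bmoment E n P.
Proof.
move=> n0 E1 AE AX D0 Phi; rewrite /Phi.
pose c := n.-1%:R * E ('X * btrans E n P).
pose c1 := n.-1%:R * E ('X * btrans E n ('X * P)).
pose Q := btrans E n P.
(* Two uses of the recursion leave, besides [('X^2 + t) Q], only a constant and a multiple of ['X],
   on which [A ('X^2 * _)] is explicit. The total is [E ('X^2 * Q) + c * E 'X] times the denominator
   of the coefficient in [Phi], so that it cancels the moment of ['X * ('X * P)]. *)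
have trE : btrans E n (('X^2 + t%:P) * P) = 'X^2 * Q + c%:P * 'X + c1%:P + t%:P * Q.
  rewrite mulrDl expr2 -mulrA raddfD/= btransCM (btransXM E n ('X * P)) -/c1.
  by rewrite btransXM -/c -/Q; ring.
have AX2 : A 'X^2 = 1 - t * A 1 by have := AE 1; rewrite mulr1 E1 => <-; rewrite addrK.
have AX3 : A ('X^2 * 'X) = E 'X by rewrite -[RHS]AE AX mulr0 addr0.
have e1E : E ('X * btrans E n ('X * P)) = E ('X^2 * Q) + c * E 'X.
  by rewrite btransXM -/c -/Q mulrDr raddfD/= ['X * _%:P]mulrC scalarCM mulrA -expr2.
rewrite trE; set D := 1 + _ in D0 *.
have -> : 'X^2 * ('X^2 * Q + c%:P * 'X + c1%:P + t%:P * Q) =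
    'X^2 * ('X^2 * Q) + c%:P * ('X^2 * 'X) + c1%:P * 'X^2 + t%:P * ('X^2 * Q) by ring.
rewrite !raddfD/= !scalarCM AX2 AX3.
have -> : ('X^2 + t%:P) * P = 'X * ('X * P) + t%:P * P by ring.
rewrite raddfD/= scalarCM bmomentXM// e1E.
have := AE ('X^2 * Q); rewrite /c1 e1E => /(canRL (addrK _)) ->.
by rewrite /D in D0 *; field.
Qed.

(** Moment version of [0 <= (C - y) / (C + t) <= C / (C + t)] for [0 <= y <= C]. Once the square is
    expanded, boundedness applied to ['X * P] leaves the error [- C * L (('X * P) ^+ 2)], which is
    nonpositive. *)
Lemma bmoment_contraction (R : realFieldType) (L : {scalar {poly R}}) (C t : R)
    (P : {poly R}) : 0 <= C -> 0 < t -> (forall P : {poly R}, 0 <= L (P ^+ 2)) ->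
  (forall P : {poly R}, L ('X^2 * P ^+ 2) <= C * L (P ^+ 2)) ->
  L (((C + t)^-1 *: (C%:P - 'X^2) * P) ^+ 2) <= (C / (C + t)) ^+ 2 * L (P ^+ 2).
Proof.
move=> C0 t0 L0 LC.
have h : L (((C%:P - 'X^2) * P) ^+ 2) <= C ^+ 2 * L (P ^+ 2).
  have -> : ((C%:P - 'X^2) * P) ^+ 2 =
      (C ^+ 2)%:P * P ^+ 2 - (2 * C)%:P * ('X * P) ^+ 2 + 'X^2 * ('X * P) ^+ 2.
    by rewrite !polyCM polyC_natr; ring.
  rewrite raddfD raddfB/= !scalarCM.
  have := LC ('X * P); have := mulr_ge0 C0 (L0 ('X * P)); lra.
have Ct : 0 < C + t by lra.
rewrite -scalerAl exprZn [L _](_ : _ = (C + t)^-1 ^+ 2 * L (((C%:P - 'X^2) * P) ^+ 2)).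
  rewrite expr_div_n exprVn.
  by rewrite [leRHS]mulrAC mulrC ler_pM2r// invr_gt0 exprn_gt0.
exact: linearZ.
Qed.

(** * Existence of a law with given bounded moments *)

(** Takes the place of Helly's selection theorem: one ultrafilter makes a family of bounded
    sequences converge simultaneously, here the tail functions at all points. *)
Lemma ultrafilter_cvg (R : realType) (T : Type) (G : set_system T) (u : T -> R) :
  UltraFilter G -> (forall x, 0 <= u x <= 1) -> exists l : R, u @ G --> l.
Proof.
move=> GU u01.
have : compact (`[0, 1]%classic : set R) by exact: segment_compact.
have GI : G (u @^-1` `[0, 1]%classic).
  by apply: filterS (@filterT _ G _) => x _ /=; rewrite in_itv/= u01.
move=> /(_ (u @ G) _ GI)[l [_ cl]]; exists l => A Al.
have [//|GA] := in_ultra_setVsetC (u @^-1` A) GU.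
by have [x [/=]] := cl (~` A) A GA Al.
Qed.

(** Both sides equal [N! / (i! (N - k - i)!)]. *)
Lemma ffact_bin (N k i : nat) : (k <= N)%N -> (i <= N - k)%N ->
  ((i + k) ^_ k * 'C(N, i + k) = N ^_ k * 'C(N - k, i))%N.
Proof.
move=> kN iNk; have ikN : (i + k <= N)%N by lia.
apply/eqP; rewrite -(@eqn_pmul2r (i`! * (N - k - i)`!)); last first.
  by rewrite muln_gt0 !fact_gt0.
have := bin_fact ikN; have := bin_fact iNk; have := ffact_fact kN.
have := @ffact_fact (i + k) k (leq_addl _ _); rewrite addnK.
rewrite subnDA subnAC => h1 h2 h3 h4; apply/eqP.
transitivity (N`!).
  by rewrite -h4 -h1; ring.
by rewrite -h2 -h3; ring.
Qed.

(** The error of replacing powers by falling factorials is [O(N^(k-1))] uniformly in [j <= N]; the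
    factor [N] on the left avoids the exponent [k - 1]. *)
Lemma ffact_expn_le (R : realDomainType) (k : nat) :
  exists2 c : R, 0 <= c & forall j N : nat, (j <= N)%N ->
    0 <= (j ^ k)%:R - (j ^_ k)%:R :> R /\
    N%:R * ((j ^ k)%:R - (j ^_ k)%:R) <= c * N%:R ^+ k.
Proof.
elim: k => [|k [c c0 ih]].
  by exists 0 => // j N _; rewrite subrr lexx mulr0 mul0r.
exists (c + k%:R); first by rewrite addr_ge0.
move=> j N jN; have [h1 h2] := ih j N jN.
have jNR : j%:R <= N%:R :> R by rewrite ler_nat.
have -> : (j ^ k.+1)%:R - (j ^_ k.+1)%:R =
    j%:R * ((j ^ k)%:R - (j ^_ k)%:R) + k%:R * (j ^_ k)%:R :> R.
  rewrite expnS ffactnSr !natrM; have [kj|jk] := leqP k j.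
    by rewrite natrB//; ring.
  by rewrite ffact_small//; ring.
split; first by rewrite addr_ge0// mulr_ge0.
rewrite mulrDr mulrDl lerD//.
  by rewrite mulrCA exprS [leRHS]mulrCA ler_pM// mulr_ge0.
rewrite exprS mulrCA ler_wpM2l// ler_wpM2l//.
have : (j ^_ k)%:R <= (j ^ k)%:R :> R by rewrite -subr_ge0.
by move=> /le_trans; apply; rewrite natrX lerXn2r// nnegrE.
Qed.

(** * Bernstein approximation of a positive functional on the unit interval *)

Section Bernstein.
Variables (R : realType) (L : {scalar {poly R}}).
Hypothesis L1 : L 1 = 1.
Hypothesis L_ge0 : forall i j, 0 <= L ('X ^+ i * (1 - 'X) ^+ j).

(** The mass at [j / N] of the [N]-th discrete approximation of [L]. *)
Definition bweight (N j : nat) : R := 'C(N, j)%:R * L ('X ^+ j * (1 - 'X) ^+ (N - j)).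

Lemma bweight_ge0 N j : 0 <= bweight N j.
Proof. by rewrite mulr_ge0. Qed.

(** The falling factorial is absorbed by the binomial coefficient, and ['X^k] times the expansion of
    [('X + (1 - 'X))^(N - k)] remains. Factorial moments of the weights are thus exact, whereas
    powers are only asymptotically so. *)
Lemma bernstein_ffact (N k : nat) : (k <= N)%N ->
  \sum_(j < N.+1) (j ^_ k * 'C(N, j))%:R *: ('X ^+ j * (1 - 'X) ^+ (N - j))
  = (N ^_ k)%:R *: ('X ^+ k : {poly R}).
Proof.
move=> kN.
rewrite -(big_mkord xpredT (fun j => (j ^_ k * 'C(N, j))%:R *: ('X ^+ j * (1 - 'X) ^+ (N - j)) : {poly R})).
rewrite (big_cat_nat (n := k))//=; last exact: leqW.
rewrite big1_seq ?add0r; last first.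
  move=> j /andP[_]; rewrite mem_index_iota => /andP[_ jk].
  by rewrite ffact_small// mul0n scale0r.
rewrite -{1}[k]add0n big_addn subSn// big_mkord.
have := exprDn (1 - 'X : {poly R}) 'X (N - k).
rewrite subrK expr1n => /(congr1 (fun p => (N ^_ k)%:R *: ('X^k * p))).
rewrite mulr1 mulr_sumr scaler_sumr => ->; apply: eq_bigr => i _.
have iNk : (i <= N - k)%N by rewrite -ltnS.
rewrite ffact_bin// subnDA subnAC natrM -scalerA; congr (_ *: _).
by rewrite scaler_nat -mulrnAr exprD; ring.
Qed.

Lemma bweight_ffact (N k : nat) : (k <= N)%N ->
  \sum_(j < N.+1) (j ^_ k)%:R * bweight N j = (N ^_ k)%:R * L 'X^k.
Proof.
move=> kN; rewrite -[RHS]/(_ *: L 'X^k) -linearZ/= -bernstein_ffact// raddf_sum/=.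
by apply: eq_bigr => j _; rewrite linearZ/= /bweight natrM mulrA.
Qed.

Lemma bweight_sum N : \sum_(j < N.+1) bweight N j = 1.
Proof.
have := @bweight_ffact N 0 (leq0n _); rewrite expr0 L1 mulr1 => h.
by apply: etrans h; apply: eq_bigr => j _; rewrite mul1r.
Qed.

Lemma bernstein_cvg k :
  (\sum_(j < N.+1) (j%:R / N%:R) ^+ k * bweight N j) @[N --> \oo] --> L 'X^k.
Proof.
have [c c0 hc] := ffact_expn_le R k.
apply/cvgrPdist_le => e e0.
near=> N.
have kN : (k <= N)%N by near: N; exact: nbhs_infty_ge.
have N0 : (0 < N)%N by near: N; exact: nbhs_infty_gt.
have NR0 : 0 < N%:R :> R by rewrite ltr0n.
have Nk0 : 0 < N%:R ^+ k :> R by rewrite exprn_gt0.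
set S := \sum_(_ < _) _.
have SE : N%:R ^+ k * S = \sum_(j < N.+1) (j ^ k)%:R * bweight N j.
  rewrite mulr_sumr; apply: eq_bigr => j _.
  by rewrite expr_div_n natrX mulrA [_ * (_ / _)]mulrC divfK// gt_eqF.
have d1 : 0 <= N%:R ^+ k * S - (N ^_ k)%:R * L 'X^k /\
    N%:R * (N%:R ^+ k * S - (N ^_ k)%:R * L 'X^k) <= c * N%:R ^+ k.
  rewrite SE -bweight_ffact// -sumrB; split.
    apply: sumr_ge0 => j _; rewrite -mulrBl mulr_ge0// ?bweight_ge0//.
    by have [] := hc j N (ltnSE (ltn_ord j)).
  have -> : c * N%:R ^+ k = \sum_(j < N.+1) c * N%:R ^+ k * bweight N j.
    by rewrite -mulr_sumr bweight_sum mulr1.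
  rewrite mulr_sumr ler_sum// => j _.
  rewrite -mulrBl mulrA ler_wpM2r ?bweight_ge0//.
  by have [] := hc j N (ltnSE (ltn_ord j)).
have [d20 d2] := hc N N (leqnn _); rewrite natrX in d20 d2.
have LX0 : 0 <= L 'X^k by have := L_ge0 k 0; rewrite expr0 mulr1.
(* One [c] pays for [j^k] against [j^_k], the term [c * L 'X^k] for [N^k] against [N^_k]. *)
have : N%:R * `|L 'X^k - S| <= c * (1 + L 'X^k).
  rewrite -(ler_pM2l Nk0) mulrCA -{1}(gtr0_norm Nk0) -normrM.
  rewrite -(gtr0_norm NR0) -normrM (gtr0_norm NR0).
  case: d1 => d10 d1.
  have h : N%:R * (N%:R ^+ k - (N ^_ k)%:R) * L 'X^k <= c * N%:R ^+ k * L 'X^k.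
    by rewrite ler_wpM2r.
  have h0 : 0 <= N%:R * (N%:R ^+ k - (N ^_ k)%:R) * L 'X^k by rewrite !mulr_ge0.
  have h1 : 0 <= N%:R * (N%:R ^+ k * S - (N ^_ k)%:R * L 'X^k) by rewrite mulr_ge0.
  have cD0 : 0 <= c * N%:R ^+ k by rewrite mulr_ge0// ltW.
  have cDL0 : 0 <= c * N%:R ^+ k * L 'X^k by rewrite mulr_ge0.
  rewrite ler_norml; apply/andP; split; lra.
have : c * (1 + L 'X^k) <= N%:R * e.
  rewrite -ler_pdivrMr//.
  by near: N; exact: nbhs_infty_ger.
by move=> h /le_trans/(_ h); rewrite ler_pM2l.
Unshelve. all: by end_near. Qed.

End Bernstein.

(** A pointwise limit of distribution functions need not be right continuous. The infimum of [f]
    over []x, +oo[] is, and comparing it with [f] at two distinct points costs only an arbitrarily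
    small shift. *)
Lemma right_regularization (R : realType) (f : R -> R) :
  {homo f : x y / x <= y} -> (forall x, x < 0 -> f x = 0) ->
  (forall x, 1 <= x -> f x = 1) ->
  exists P : probability (measurableTypeR R) R,
    forall x y, x < y -> ((f x)%:E <= P `]-oo, x]%classic <= (f y)%:E)%E.
Proof.
move=> ndf f0 f1.
have f_ge0 x : 0 <= f x.
  have [x0|x0] := ltP x 0; first by rewrite f0.
  by rewrite -(f0 (-1)) ?ltrN10// ndf// (le_trans _ x0)// lerN10.
pose g x := inf (f @` `]x, +oo[).
have inf_f x : has_inf (f @` `]x, +oo[).
  split; first by exists (f (x + 1)); exists (x + 1) => //=; rewrite in_itv/= ltrDl ltr01.
  by exists 0 => u [y _ <-].
have gf x y : x < y -> g x <= f y.
  move=> xy; apply: ge_inf; first by case: (inf_f x).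
  by exists y => //=; rewrite in_itv/= xy.
have lb_g x y : (forall z, x < z -> y <= f z) -> y <= g x.
  move=> h; apply: lb_le_inf; first by case: (inf_f x).
  by move=> u [z /=]; rewrite in_itv/= andbT => xz <-; exact: h.
have fg x : f x <= g x by apply: lb_g => z xz; rewrite ndf// ltW.
have ndg : nondecreasing g.
  by move=> x y xy; apply: lb_g => z yz; exact/gf/(le_lt_trans xy).
have rcg : right_continuous g.
  move=> x; apply/cvgrPdist_le => e e0.
  have [u [z /=]] := inf_adherent e0 (inf_f x).
  rewrite in_itv/= andbT => xz <- fz.
  near=> y.
  have xy : x < y by near: y; exact: nbhs_right_gt.
  have yz : y < z by near: y; exact: nbhs_right_lt.
  have := gf _ _ yz; have := ndg _ _ (ltW xy); rewrite -/(g x) in fz.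
  by move=> h1 h2; rewrite ler_norml; lra.
have g0 : g @ -oo --> (0 : R).
  apply: cvg_near_cst; near=> x.
  have x0 : x < 0 by near: x; exact: nbhs_ninfty_lt.
  apply/eqP; rewrite eq_le (le_trans (f_ge0 x))// andbT.
  by rewrite (le_trans (gf x (x / 2) _))// ?f0//; lra.
have g1 : g @ +oo --> (1 : R).
  apply: cvg_near_cst; near=> x.
  have x1 : 1 <= x by near: x; exact: nbhs_pinfty_ge.
  apply/eqP; rewrite eq_le -{2}(f1 _ x1) fg andbT.
  by rewrite (le_trans (gf x (x + 1) _)) ?f1//; lra.
pose c := isCumulative.Build R _ R g ndg rcg.
pose b := isCumulativeBounded.Build R 0 1 g g0 g1.
pose G : cumulativeBounded (0 : R) 1 := HB.pack g c b.
exists (lebesgue_stieltjes_measure G) => x y xy.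
have := cdf_lebesgue_stieltjes_id G x; rewrite /cdf/= /distribution/= /pushforward/=.
rewrite preimage_id => ->.
by rewrite !lee_fin fg gf.
Unshelve. all: by end_near. Qed.

(** The increments of [h] telescope along the grid; the cell that contains [x] is counted on the
    right only. *)
Lemma staircase (R : realFieldType) (h : R -> R) (a : nat -> R) (x : R) (m : nat) :
  {in Num.nneg &, {homo h : u v / u <= v}} ->
  {homo a : i j / (i <= j)%N >-> i <= j} -> a 0%N = 0 -> 0 <= x ->
  \sum_(i < m) (h (a i.+1) - h (a i)) * (a i.+1 < x)%R%:R <= h (Num.min x (a m)) - h 0
  <= \sum_(i < m) (h (a i.+1) - h (a i)) * (a i < x)%R%:R.
Proof.
move=> ndh nda a0 x0.
have a_ge0 i : 0 <= a i by rewrite -a0 nda.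
have dh i : 0 <= h (a i.+1) - h (a i) by rewrite subr_ge0 ndh ?nnegrE// nda.
elim: m => [|m /andP[ih1 ih2]].
  by rewrite !big_ord0 a0 (min_idPr x0) subrr lexx.
rewrite !big_ord_recr/=; have am := nda _ _ (leqnSn m).
apply/andP; split.
  have [xm|xm] := ltP (a m.+1) x.
    rewrite mulr1; rewrite (min_idPr _) in ih1; last exact/ltW/(le_lt_trans am).
    by lra.
  rewrite mulr0 addr0 (le_trans ih1)// lerB// ndh ?nnegrE ?le_min ?x0 ?a_ge0//.
  by rewrite ge_min lexx.
have [xm|xm] := ltP (a m) x.
  rewrite mulr1; rewrite (min_idPr _) in ih2; last exact: ltW.
  have : h (Num.min x (a m.+1)) <= h (a m.+1).
    by rewrite ndh ?nnegrE ?le_min ?x0 ?a_ge0// ge_min lexx orbT.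
  by lra.
rewrite mulr0 addr0 (min_idPl _) ?(le_trans xm)//.
by rewrite (min_idPl _) in ih2.
Qed.

(** Integrands built from [clamp] are bounded at every point, whatever the support of the
    measure. *)
Definition clamp (R : realType) (x : R) : R := Num.max 0 (Num.min x 1).

Lemma clamp01 (R : realType) (x : R) : 0 <= clamp x <= 1.
Proof. by rewrite /clamp le_max lexx/= ge_max ler01/= ge_min lexx orbT. Qed.

Lemma measurable_clamp (R : realType) : measurable_fun setT (@clamp R).
Proof.
apply: measurable_maxr; first exact: measurable_cst.
by apply: measurable_minr; [exact: measurable_id|exact: measurable_cst].
Qed.

Lemma integral_staircase (R : realType) (P : probability (measurableTypeR R) R)
    (r : nat) (d a : nat -> R) : (forall i, 0 <= d i) ->
  (\int[P]_x (\sum_(i < r) d i * (a i < x)%R%:R)%:E =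
   (\sum_(i < r) d i * fine (P `]a i, +oo[%classic))%:E)%E.
Proof.
move=> d0.
have indE i x : (a i < x)%R%:R = \1_(`]a i, +oo[%classic) x :> R.
  by rewrite indicE mem_setE/= in_itv/= andbT.
under eq_integral do rewrite -sumEFin.
have mind i : measurable_fun setT (fun x : measurableTypeR R => (a i < x)%R%:R : R).
  rewrite (_ : (fun _ => _) = \1_(`]a i, +oo[%classic)); first exact: measurable_indic.
  by apply/funext => x; rewrite indE.
rewrite ge0_integral_sum//; last 2 first.
  by move=> i; apply/measurable_EFinP; exact: measurable_funM.
  by move=> i x _; rewrite lee_fin mulr_ge0.
rewrite -sumEFin; apply: eq_bigr => i _.
under eq_integral do rewrite EFinM.
rewrite ge0_integralZl_EFin//; last first.
  exact/measurable_EFinP.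
under eq_integral do rewrite indE.
by rewrite integral_indic// setIT EFinM fineK// fin_num_measure.
Qed.

(* The Bernstein weights of [L] are discrete laws whose moments converge to
   those of [L]. Limits along an ultrafilter of their tail functions are
   regularized into a law, and Abel summation over a regular grid compares its
   moments with [L]. *)
Lemma hausdorff_moments (R : realType) (L : {scalar {poly R}}) :
  L 1 = 1 -> (forall i j, 0 <= L ('X ^+ i * (1 - 'X) ^+ j)) ->
  exists P : probability (measurableTypeR R) R,
    forall k, (\int[P]_x (clamp x ^+ k)%:E = (L 'X^k)%:E)%E.
Proof.
move=> L1 L_ge0; pose w := bweight L.
have w0 N j : 0 <= w N j by exact: bweight_ge0.
have [G [GU ooG]] := @ultraFilterLemma nat \oo _.
have jN01 N (j : 'I_N.+1) : 0 <= (j%:R / N%:R : R) <= 1.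
  rewrite divr_ge0//=; have [N0|N0] := posnP N.
    by rewrite (_ : N%:R = 0 :> R) ?N0// invr0 mulr0.
  by rewrite ler_pdivrMr ?ltr0n// mul1r ler_nat -ltnS.
pose tail N (x : R) := \sum_(j < N.+1) w N j * (x < j%:R / N%:R)%R%:R.
have tail01 x N : 0 <= tail N x <= 1.
  rewrite sumr_ge0/=; last by move=> j _; rewrite mulr_ge0.
  rewrite -(bweight_sum L1 N) ler_sum// => j _.
  by rewrite ler_piMr// lern1 leq_b1.
have /choice[g gE] x : exists l : R, (tail^~ x) @ G --> l.
  exact: ultrafilter_cvg.
have gcst x b : (forall N, tail N x = b) -> g x = b.
  move=> h; apply: (cvg_unique _ (gE x)) => //.
  by rewrite (_ : tail^~ x = cst b); [exact: cvg_cst|exact/funext].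
have g01 x : 0 <= g x <= 1.
  apply/andP; split.
    by apply: (ler_cvg_to (cvg_cst 0) (gE x)); apply: nearW => N; case/andP: (tail01 x N).
  by apply: (ler_cvg_to (gE x) (cvg_cst (1 : R))); apply: nearW => N; case/andP: (tail01 x N).
have ndg : {homo g : x y / x <= y >-> y <= x}.
  move=> x y xy; apply: (ler_cvg_to (gE y) (gE x)); apply: nearW => N.
  apply: ler_sum => j _; rewrite ler_wpM2l// ler_nat.
  by case: (ltP y) => // /(le_lt_trans xy) ->.
have g0 x : x < 0 -> g x = 1.
  move=> x0; apply: gcst => N; rewrite -(bweight_sum L1 N).
  by apply: eq_bigr => j _; rewrite (lt_le_trans x0) ?mulr1//; case/andP: (jN01 N j).
have g1 x : 1 <= x -> g x = 0.
  move=> x1; apply: gcst => N; apply: big1 => j _.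
  by rewrite ltNge (le_trans _ x1) ?mulr0//; case/andP: (jN01 N j).
have [||| P Pg] := @right_regularization R (fun x => 1 - g x).
- by move=> x y xy; rewrite lerB// ndg.
- by move=> x x0; rewrite g0// subrr.
- by move=> x x1; rewrite g1// subr0.
exists P => k.
have Ptail x y : x < y -> g y <= fine (P `]x, +oo[%classic) <= g x.
  move=> xy; have := Pg _ _ xy.
  rewrite -setCitvl probability_setC//.
  rewrite -[P _]fineK ?fin_num_measure// !lee_fin -EFinB/=.
  by move=> /andP[h1 h2]; apply/andP; split; lra.
have [->|k0] := posnP k.
  under eq_integral do rewrite expr0.
  by rewrite integral_cst// expr0 L1 mul1e; exact: probability_setT.
have X0k : 0 ^+ k = 0 :> R by rewrite expr0n gtn_eqF.
pose I := (\int[P]_x (clamp x ^+ k)%:E)%E.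
have mck : measurable_fun setT (fun x : measurableTypeR R => clamp x ^+ k).
  by apply: measurable_funX; exact: measurable_clamp.
have ck0 (x : R) : 0 <= clamp x ^+ k by rewrite exprn_ge0//; case/andP: (clamp01 x).
suff bound r : (0 < r)%N -> exists2 s : R,
    I = s%:E & `|s - L 'X^k| <= k%:R * 2 / r%:R.
  have [s Is _] := bound 1%N isT; rewrite -/I Is; congr EFin.
  apply/eqP; rewrite -subr_eq0 -normr_le0; apply/ler_addgt0Pl => e e0.
  rewrite addr0; pose r := (Num.truncn (k%:R * 2 / e)).+1.
  have [s' Is' s'L] := bound r isT; move: s'L.
  have -> : s' = s by move: Is'; rewrite Is => -[].
  move=> /le_trans; apply; rewrite ler_pdivrMr ?ltr0n// -ler_pdivrMl// mulrC.
  exact/ltW/truncnS_gt.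
move=> r0; have rR0 : 0 < r%:R :> R by rewrite ltr0n.
pose a i : R := i%:R / r%:R.
have nda : {homo a : i j / (i <= j)%N >-> i <= j}.
  by move=> i j ij; rewrite ler_pM2r ?invr_gt0// ler_nat.
have a0 : a 0%N = 0 by rewrite /a mul0r.
have ar : a r = 1 by rewrite /a divff// gt_eqF.
have a_ge0 i : 0 <= a i by rewrite /a divr_ge0.
have aS i : a i < a i.+1 by rewrite /a ltr_pM2r ?invr_gt0// ltr_nat.
have ndX : {in Num.nneg &, {homo (fun x : R => x ^+ k) : u v / u <= v}}.
  by move=> u v u0 v0 uv; rewrite lerXn2r.
pose c i := a i.+1 ^+ k - a i ^+ k.
have c0 i : 0 <= c i by rewrite subr_ge0 ndX ?nnegrE// ltW.
have stair x : 0 <= x <= 1 ->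
    \sum_(i < r) c i * (a i.+1 < x)%R%:R <= x ^+ k <= \sum_(i < r) c i * (a i < x)%R%:R.
  move=> /andP[x0 x1]; have := staircase r ndX nda a0 x0.
  by rewrite ar (min_idPl x1) X0k subr0.
(* [L 'X^k] lies between [S 1] and [S 0], the integral between [S 2] and [S 0]: a lower staircase
   shifts the grid by one node, and the regularization of the tails costs one more. *)
pose S s := \sum_(i < r) c i * g (a (i + s)%N).
have S_cvg s : (\sum_(i < r) c i * tail N (a (i + s)%N)) @[N --> G] --> S s.
  apply: (@cvg_big _ _ +%R) => [|i _]; first exact: add_continuous.
  by apply: cvgMr; exact: gE.
have B_cvg : (\sum_(j < N.+1) (j%:R / N%:R) ^+ k * w N j) @[N --> G] --> L 'X^k.
  by move=> A /(@bernstein_cvg _ _ L1 L_ge0 k) /ooG.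
have tailE N s : \sum_(i < r) c i * tail N (a (i + s)%N) =
    \sum_(j < N.+1) (\sum_(i < r) c i * (a (i + s)%N < j%:R / N%:R)%R%:R) * w N j.
  under eq_bigr do rewrite mulr_sumr.
  rewrite exchange_big/=; apply: eq_bigr => j _; rewrite mulr_suml.
  by apply: eq_bigr => i _; rewrite mulrA mulrAC.
have L_le : L 'X^k <= S 0%N.
  apply: (ler_cvg_to B_cvg (S_cvg 0%N)); apply: nearW => N; rewrite tailE.
  apply: ler_sum => j _; rewrite ler_wpM2r//.
  under eq_bigr do rewrite addn0.
  by case/andP: (stair _ (jN01 N j)).
have L_ge : S 1%N <= L 'X^k.
  apply: (ler_cvg_to (S_cvg 1%N) B_cvg); apply: nearW => N; rewrite tailE.
  apply: ler_sum => j _; rewrite ler_wpM2r//.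
  under eq_bigr do rewrite addn1.
  by case/andP: (stair _ (jN01 N j)).
have mstair (d b : nat -> R) : measurable_fun setT
    (fun x : measurableTypeR R => \sum_(i < r) d i * (b i < x)%R%:R).
  apply: measurable_sum => i; apply: measurable_funM => //.
  rewrite (_ : (fun _ => _) = \1_(`]b i, +oo[%classic)); first exact: measurable_indic.
  by apply/funext => x; rewrite indicE mem_setE/= in_itv/= andbT.
have I_le : (I <= (S 0%N)%:E)%E.
  apply: (@le_trans _ _ (\int[P]_x (\sum_(i < r) c i * (a i < x)%R%:R)%:E)%E).
    apply: ge0_le_integral => //.
    - by move=> x _; rewrite lee_fin.
    - exact/measurable_EFinP.
    - exact/measurable_EFinP.
    - move=> x _; rewrite lee_fin.
      have /stair/andP[_ /le_trans] := clamp01 x; apply.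
      apply: ler_sum => i _; rewrite ler_wpM2l// ler_nat.
      rewrite /clamp lt_max lt_min ltNge a_ge0/=.
      by case: (a i < x)%R => //=; case: (a i < 1)%R.
  rewrite integral_staircase// lee_fin ler_sum// => i _; rewrite addn0 ler_wpM2l//.
  by case/andP: (Ptail _ _ (aS i)).
have I_ge : ((S 2%N)%:E <= I)%E.
  (* For [x > 1] the clamped point is [1], which does not exceed the last node [a r = 1], so the
     last term is removed. Nothing is lost, since [g] vanishes from [1] on. *)
  pose d i := c i * (a i.+1 < 1)%R%:R.
  have d0 i : 0 <= d i by rewrite mulr_ge0.
  apply: (@le_trans _ _ (\int[P]_x (\sum_(i < r) d i * (a i.+1 < x)%R%:R)%:E)%E).
    rewrite (integral_staircase P r (a \o succn) d0) lee_fin ler_sum// => i _.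
    rewrite addn2 /d/=; have [a1|a1] := ltP (a i.+1) 1.
      by rewrite mulr1 ler_wpM2l//; case/andP: (Ptail _ _ (aS i.+1)).
    by rewrite mulr0 mul0r g1 ?mulr0//; exact/(le_trans a1)/ltW.
  apply: ge0_le_integral => //.
  - by move=> x _; rewrite lee_fin sumr_ge0// => i _; rewrite mulr_ge0.
  - by apply/measurable_EFinP; exact: (mstair d (fun i => a i.+1)).
  - exact/measurable_EFinP.
  - move=> x _; rewrite lee_fin.
    have /stair/andP[+ _] := clamp01 x; apply: le_trans.
    apply: ler_sum => i _; rewrite /d -mulrA ler_wpM2l// -natrM ler_nat.
    rewrite /clamp lt_max lt_min.
    by case: (a i.+1 < x)%R; case: (a i.+1 < 1)%R; rewrite ?orbT.
have cb i : (i < r)%N -> c i <= k%:R / r%:R.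
  move=> ir; have aS1 : a i.+1 <= 1 by rewrite -ar nda.
  rewrite /c subrXX.
  have -> : a i.+1 - a i = r%:R^-1 by rewrite /a -mulrBl -natr1 addrAC subrr add0r mul1r.
  rewrite mulrC ler_pM2r ?invr_gt0//.
  apply: (@le_trans _ _ (\sum_(j < k) 1)); last by rewrite sumr_const card_ord.
  apply: ler_sum => j _; rewrite mulr_ile1 ?exprn_ge0// exprn_ile1//.
  exact/(le_trans (ltW (aS i))).
have Sdiff : S 0%N - S 2%N <= k%:R * 2 / r%:R.
  rewrite /S -sumrB.
  apply: (@le_trans _ _ (\sum_(i < r) k%:R / r%:R * (g (a i) - g (a i.+2)))).
    apply: ler_sum => i _; rewrite addn0 addn2 -mulrBr ler_wpM2r ?cb//.
    by rewrite subr_ge0 ndg// nda//; lia.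
  rewrite -mulr_sumr [leRHS]mulrAC ler_wpM2l ?divr_ge0//.
  (* A difference over two nodes telescopes through [u], whose values lie in [[0, 2]]; hence the
     factor 2 in the bound. *)
  pose u i := g (a i) + g (a i.+1).
  have -> : \sum_(i < r) (g (a i) - g (a i.+2)) = u 0%N - u r.
    rewrite -opprB -telescope_sumr// -sumrN big_mkord; apply: eq_bigr => i _.
    by rewrite /u; lra.
  have [/andP[h1 h2] /andP[h3 h4]] := (g01 (a 0%N), g01 (a 1%N)).
  have [/andP[h5 h6] /andP[h7 h8]] := (g01 (a r), g01 (a r.+1)).
  by rewrite /u; lra.
have : I \is a fin_num.
  rewrite ge0_fin_numE ?(le_lt_trans I_le) ?ltry//.
  by apply: integral_ge0 => x _; rewrite lee_fin.
move=> /fineK sI; exists (fine I) => //.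
move: I_le I_ge; rewrite -sI !lee_fin => I_le I_ge.
have S12 : S 2%N <= S 1%N.
  by apply: ler_sum => i _; rewrite ler_wpM2l// ndg// nda// leq_add2l.
by rewrite ler_norml; apply/andP; split; lra.
Qed.

Section PolynomialIntegral.
Context d (T : measurableType d) (R : realType) (mu : {measure set T -> \bar R}).
Variable f : T -> R.
Hypothesis intf : forall k, mu.-integrable setT (fun x => (f x ^+ k)%:E).

Lemma integrable_horner (q : {poly R}) :
  mu.-integrable setT (fun x => (q.[f x])%:E).
Proof.
under eq_fun do rewrite horner_coef -sumEFin.
apply: integrable_sum => // i _; under eq_fun do rewrite EFinM.
exact: integrableZl.
Qed.

Lemma Rintegral_horner_linear : scalar (fun q : {poly R} => \int[mu]_x q.[f x]).
Proof.
move=> a p q /=; under eq_Rintegral do rewrite hornerD hornerZ.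
rewrite RintegralD//; last 2 first.
- by under eq_fun do rewrite /= -hornerZ; exact: integrable_horner.
- exact: integrable_horner.
by rewrite RintegralZl//; exact: integrable_horner.
Qed.

Lemma Rintegral_horner (L : {scalar {poly R}}) (q : {poly R}) :
  (forall k, \int[mu]_x (f x ^+ k) = L 'X^k) -> \int[mu]_x q.[f x] = L q.
Proof.
move=> fL; pose F : {scalar {poly R}} := HB.pack
  (fun q : {poly R} => \int[mu]_x q.[f x]) (GRing.isLinear.Build _ _ _ _ _ Rintegral_horner_linear).
rewrite -[LHS]/(F q); apply: poly_span => k /=.
by rewrite -fL; apply: eq_Rintegral => x _; rewrite hornerXn.
Qed.

End PolynomialIntegral.

(** The affine map [l] carries the problem to [[0, 1]]. Positivity on [l^i (1 - l)^j] reduces to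
    [i, j <= 1], because even powers go into the square [P ^+ 2]. *)
Lemma bounded_moments (R : realType) (L : {scalar {poly R}}) (C : R) :
  L 1 = 1 -> (forall P : {poly R}, 0 <= L (P ^+ 2)) -> 0 <= C ->
  (forall P : {poly R}, L ('X^2 * P ^+ 2) <= C * L (P ^+ 2)) ->
  exists P : probability (measurableTypeR R) R, forall k,
    P.-integrable setT (fun x => (x ^+ k)%:E) /\ \int[P]_x (x ^+ k) = L 'X^k.
Proof.
(* This [D] satisfies [D^2 >= C] without a square root; the law is built on [[-D, D]]. *)
move=> L1 L_ge0 C0 LC; pose D := C + 1.
have D0 : 0 < 2 * D by rewrite /D; lra.
have LD P : 0 <= L ((D ^+ 2 *: 1 - 'X^2) * P ^+ 2).
  rewrite mulrBl -scalerAl mul1r linearB linearZ/= subr_ge0 (le_trans (LC P))//.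
  by rewrite ler_wpM2r// /D; nra.
pose l : {poly R} := (2 * D)^-1 *: ('X + D *: 1).
have l1 : 1 - l = (2 * D)^-1 *: (D *: 1 - 'X).
  apply: (scalerI (lt0r_neq0 D0)); rewrite scalerBr !scalerA divff ?gt_eqF// !scale1r.
  by rewrite mulr2n !mulrDl !mul1r scalerDl; ring.
(* For [s = D + 'X] or [s = D - 'X], [2 D s] is the sum of [s^2] and of [D^2 - 'X^2], which [LD]
   handles. *)
have half (s : {poly R}) P : s ^+ 2 = (2 * D) *: s - (D ^+ 2 *: 1 - 'X^2) ->
    0 <= L ((2 * D)^-1 *: s * P ^+ 2).
  move=> sE; rewrite -scalerAl linearZ/= mulr_ge0// ?invr_ge0 ?(ltW D0)//.
  rewrite -(pmulr_rge0 _ D0) -[_ * L _]/(_ *: L _) -linearZ/=.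
  rewrite scalerAl -[_ *: s](subrK (D ^+ 2 *: 1 - 'X^2)) -sE mulrDl -exprMn linearD/=.
  by rewrite addr_ge0.
have Ll P : 0 <= L (l * P ^+ 2).
  by apply: half; rewrite -!mul_polyC !polyCM polyC_natr; ring.
have Ll1 P : 0 <= L ((1 - l) * P ^+ 2).
  by rewrite l1; apply: half; rewrite -!mul_polyC !polyCM polyC_natr; ring.
have Lll P : 0 <= L (l * (1 - l) * P ^+ 2).
  have -> : l * (1 - l) * P ^+ 2 = (1 - l) * (l * P) ^+ 2 + l * ((1 - l) * P) ^+ 2.
    by ring.
  by rewrite linearD/= addr_ge0.
pose L' (P : {poly R}) := L (P \Po l).
have L'lin : scalar L' by move=> a P Q; rewrite /L' linearP linearP.
pose M : {scalar {poly R}} := HB.pack L' (GRing.isLinear.Build _ _ _ _ _ L'lin).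
have [||P PE] := @hausdorff_moments R M.
- by rewrite /= /L' -polyC1 comp_polyC polyC1.
- move=> i j; rewrite /= /L' rmorphM !rmorphXn rmorphB/= rmorph1 comp_polyX.
  rewrite -(odd_double_half i) -(odd_double_half j) -!muln2 !exprD !exprM.
  rewrite mulrACA -exprMn.
  case: (odd i); case: (odd j); rewrite ?expr1 ?expr0 ?mul1r ?mulr1 //.
pose phi (x : measurableTypeR R) : measurableTypeR R := 2 * D * clamp x - D.
have mphi : measurable_fun setT phi.
  apply: measurable_funB => //; apply: measurable_funM => //; exact: measurable_clamp.
pose X : {mfun measurableTypeR R >-> measurableTypeR R} :=
  HB.pack phi (isMeasurableFun.Build _ _ _ _ phi mphi).
have intc k : P.-integrable setT (fun x => (clamp x ^+ k)%:E).
  apply/integrableP; split.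
    by apply/measurable_EFinP/measurable_funX; exact: measurable_clamp.
  under eq_integral do rewrite gee0_abs ?lee_fin ?exprn_ge0 ?(andP (clamp01 _)).1//.
  by rewrite PE ltry.
exists (distribution P X) => k.
have mX : measurable_fun setT (fun x : measurableTypeR R => (x ^+ k)%:E).
  by apply/measurable_EFinP; exact: measurable_funX.
pose q : {poly R} := (2 * D *: 'X - D%:P) ^+ k.
have qE x : q.[clamp x] = phi x ^+ k.
  by rewrite /q horner_exp hornerD hornerN hornerZ hornerX hornerC.
have intphi : P.-integrable (phi @^-1` setT) ((fun x => (x ^+ k)%:E) \o phi).
  rewrite preimage_setT (_ : _ \o phi = fun x => (q.[clamp x])%:E).
    exact: integrable_horner.
  by apply/funext => x; rewrite qE.
split; first exact: (integrable_pushforward mphi).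
rewrite /Rintegral (integral_pushforward mphi)// preimage_setT.
rewrite (_ : _ \o phi = fun x => (q.[clamp x])%:E); last first.
  by apply/funext => x; rewrite qE.
rewrite -/(Rintegral _ _ _) (@Rintegral_horner _ _ _ _ _ intc M)//; last first.
  by move=> j; rewrite /Rintegral PE.
rewrite /= /L' /q rmorphXn/= rmorphB/= linearZ/= comp_polyX comp_polyC.
rewrite /l scalerA divff ?gt_eqF// scale1r -mul_polyC mulr1.
by rewrite addrK.
Qed.

(** * Transforms of laws *)

Lemma measurable_inv (R : realType) : measurable_fun setT (fun x : R => x^-1).
Proof.
have -> : [set: R] = [set x : R | x != 0] `|` [set 0].
  by apply/seteqP; split=> // x _ /=; have [->|] := eqVneq x 0; [right|left].
have o0 : open [set x : R | x != 0] by exact: open_neq.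
apply/measurable_funU => //; first exact: open_measurable.
split; last exact: measurable_fun_set1.
apply: open_continuous_measurable_fun => // x; rewrite inE/= => x0.
exact: inv_continuous.
Qed.

Section BoundedWeight.
Context d (T : measurableType d) (R : realType) (P : probability T R).

Lemma integrable_weight (g w : T -> R) (M : R) :
  P.-integrable setT (EFin \o g) -> measurable_fun setT w ->
  (forall x, `|w x| <= M) -> P.-integrable setT (EFin \o (fun x => g x * w x)).
Proof.
move=> ig mw wM.
have mg : measurable_fun setT g by apply/measurable_EFinP; exact: measurable_int ig.
apply: (@le_integrable _ _ _ _ _ _ _ (EFin \o (fun x => M * g x))) => //.
- by apply/measurable_EFinP; exact: measurable_funM.
- move=> x _; rewrite lee_fin !normrM mulrC ler_wpM2r//.
  exact: le_trans (wM x) (ler_norm _).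
- exact: (integrableZl measurableT M ig).
Qed.

Lemma integrable_weight1 (w : T -> R) (M : R) : measurable_fun setT w ->
  (forall x, `|w x| <= M) -> P.-integrable setT (EFin \o w).
Proof.
move=> mw wM; have -> : w = fun x => 1 * w x by apply/funext => x; rewrite mul1r.
apply: (integrable_weight _ mw wM).
exact: finite_measure_integrable_cst.
Qed.

Lemma Rintegral_probability_cst (a : R) : \int[P]_(x in [set: T]) a = a.
Proof.
rewrite Rintegral_cst// [X in fine X](_ : _ = 1%E) ?mulr1//.
exact: probability_setT.
Qed.

(** Cauchy-Schwarz in additive form, without square roots: a [delta] that bounds the quadratic norm
    of [g] makes the right side at most [delta]. *)
Lemma Rintegral_weight_le (g w : T -> R) (delta : R) : 0 < delta ->
  P.-integrable setT (EFin \o g) ->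
  P.-integrable setT (EFin \o (fun x => g x ^+ 2)) ->
  measurable_fun setT w -> (forall x, `|w x| <= 1) ->
  `|\int[P]_x (g x * w x)| <= (delta + (\int[P]_x (g x ^+ 2)) / delta) / 2.
Proof.
move=> d0 ig ig2 mw w1.
have igw := integrable_weight ig mw w1.
rewrite (le_trans (le_normr_Rintegral _ igw))//.
have ic : P.-integrable setT (EFin \o cst (delta / 2)).
  exact: finite_measure_integrable_cst.
have ig2' : P.-integrable setT (EFin \o (fun x => delta^-1 / 2 * g x ^+ 2)).
  exact: (integrableZl measurableT (delta^-1 / 2) ig2).
have i2 : P.-integrable setT (EFin \o (fun x => delta / 2 + delta^-1 / 2 * g x ^+ 2)).
  exact: (integrableD measurableT ic ig2').
apply: (@le_trans _ _ (\int[P]_x (delta / 2 + delta^-1 / 2 * g x ^+ 2))).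
  apply: le_Rintegral => //.
    rewrite (_ : _ \o _ = abse \o (EFin \o (fun x => g x * w x))); last exact/funext.
    exact: integrable_abse.
  move=> x _; rewrite normrM.
  apply: (@le_trans _ _ `|g x|); first by rewrite ler_piMr.
  (* AM-GM *)
  rewrite -(real_normK (num_real (g x))) -subr_ge0.
  rewrite [leRHS](_ : _ = (delta - `|g x|) ^+ 2 * (delta^-1 / 2)); last first.
    by field; rewrite gt_eqF.
  by rewrite mulr_ge0 ?sqr_ge0// divr_ge0// invr_ge0 ltW.
rewrite RintegralD// Rintegral_probability_cst RintegralZl//.
by rewrite le_eqVlt; apply/orP; left; apply/eqP; field; rewrite gt_eqF.
Qed.

End BoundedWeight.

Definition moment_functional d (T : measurableType d) (R : realType)
    (mu : {measure set T -> \bar R}) (f : T -> R)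
    (intf : forall k, mu.-integrable setT (fun x => (f x ^+ k)%:E)) :
    {scalar {poly R}} :=
  HB.pack (fun q : {poly R} => \int[mu]_x q.[f x])
    (GRing.isLinear.Build _ _ _ _ _ (Rintegral_horner_linear intf)).

(** For a symmetric law and [z = i sqrt t] this is [- G(z) / z], with [G] the Cauchy transform. The
    parameter [f] allows rescaled variables over one fixed measure. *)
Definition stieltjes d (T : measurableType d) (R : realType)
    (mu : {measure set T -> \bar R}) (f : T -> R) (t : R) : R :=
  \int[mu]_x (f x ^+ 2 + t)^-1.

Section ResolventFunction.
Context d (T : measurableType d) (R : realType).
Variable f : T -> R.
Hypothesis mf : measurable_fun setT f.
Variable t : R.
Hypothesis t0 : 0 < t.

Lemma sqrDt_gt0 (x : R) : 0 < x ^+ 2 + t.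
Proof. by rewrite ltr_wpDl// sqr_ge0. Qed.

Lemma measurable_resolvent : measurable_fun setT (fun x => (f x ^+ 2 + t)^-1).
Proof.
apply: (measurableT_comp (@measurable_inv R)).
by apply: measurable_funD => //; exact: measurable_funX.
Qed.

Lemma resolvent_le x : `|(f x ^+ 2 + t)^-1| <= t^-1.
Proof.
rewrite gtr0_norm ?invr_gt0 ?sqrDt_gt0// lef_pV2 ?posrE ?sqrDt_gt0//.
by rewrite lerDr sqr_ge0.
Qed.

End ResolventFunction.

(** * The transform of a Boolean sum *)

Section Resolvent.
Context d (T : measurableType d) (R : realType) (mu : probability T R).
Variables (f : T -> R).
Hypothesis mf : measurable_fun setT f.
Hypothesis intf : forall k, mu.-integrable setT (fun x => (f x ^+ k)%:E).
Variable (t : R).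
Hypothesis t0 : 0 < t.
Let E := moment_functional intf.

Lemma integrable_resolvent (q : {poly R}) :
  mu.-integrable setT (EFin \o (fun x => q.[f x] * (f x ^+ 2 + t)^-1)).
Proof.
apply: integrable_weight (measurable_resolvent mf t) (resolvent_le f t0).
exact: integrable_horner.
Qed.

Lemma resolvent_linear : scalar (fun q : {poly R} => \int[mu]_x (q.[f x] * (f x ^+ 2 + t)^-1)).
Proof.
move=> a p q /=; under eq_Rintegral do rewrite hornerD hornerZ mulrDl -mulrA.
rewrite RintegralD//; last 2 first.
- exact: (integrableZl measurableT a (integrable_resolvent p)).
- exact: integrable_resolvent.
by rewrite RintegralZl//; exact: integrable_resolvent.
Qed.

Let A : {scalar {poly R}} :=
  HB.pack (fun q : {poly R} => \int[mu]_x (q.[f x] * (f x ^+ 2 + t)^-1))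
    (GRing.isLinear.Build _ _ _ _ _ resolvent_linear).

Let A1 : A 1 = stieltjes mu f t.
Proof. by apply: eq_Rintegral => x _; rewrite hornerC mul1r. Qed.

Let AE q : A ('X^2 * q) + t * A q = E q.
Proof.
have -> : t * A q = A (t *: q) by rewrite linearZ.
rewrite -raddfD -mul_polyC -mulrDl.
apply: eq_Rintegral => x _; rewrite hornerM hornerD hornerXn hornerC.
by rewrite mulrAC divff ?mul1r// gt_eqF// sqrDt_gt0.
Qed.

Let E1 : E 1 = 1.
Proof.
by rewrite /=; under eq_Rintegral do rewrite hornerC; exact: Rintegral_probability_cst.
Qed.

Let E_ge0 (P : {poly R}) : 0 <= E (P ^+ 2).
Proof. by apply: Rintegral_ge0 => x _; rewrite horner_exp sqr_ge0. Qed.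

Hypothesis odd0 : \int[mu]_x (f x / (f x ^+ 2 + t)) = 0.

Let AX : A 'X = 0.
Proof. by rewrite -[RHS]odd0; apply: eq_Rintegral => x _; rewrite hornerX. Qed.

Variable n : nat.
Hypothesis n0 : (0 < n)%N.
Let g := stieltjes mu f t.
Let theta := 1 - t * g.
Let beta := (1 + n.-1%:R * theta)^-1.
Let tr := btrans E n.
Let L : {scalar {poly R}} := bmoment E n.

Let AX2 : A 'X^2 = theta.
Proof. by have := AE 1; rewrite mulr1 A1 E1 /theta -/g => <-; rewrite addrK. Qed.

Let theta_ge0 : 0 <= theta.
Proof.
rewrite -AX2; apply: Rintegral_ge0 => x _.
by rewrite hornerXn mulr_ge0 ?sqr_ge0// invr_ge0 ltW// sqrDt_gt0.
Qed.

Let beta_gt0 : 0 < beta.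
Proof. by rewrite invr_gt0 ltr_pwDl// mulr_ge0. Qed.

Variable rho : probability (measurableTypeR R) R.
Hypothesis introh : forall k, rho.-integrable setT (fun x => (x ^+ k)%:E).
Hypothesis rhoE : forall k, \int[rho]_x (x ^+ k) = L 'X^k.
Variable C : R.
Hypothesis C0 : 0 < C.
Hypothesis LC : forall P : {poly R}, L ('X^2 * P ^+ 2) <= C * L (P ^+ 2).

Let q := C / (C + t).
Let eps N : {poly R} := ((C + t)^-1 *: (C%:P - 'X^2)) ^+ N.

Let rho_horner (P : {poly R}) : \int[rho]_x P.[x] = L P.
Proof. exact: (@Rintegral_horner _ _ _ rho id introh L). Qed.

Let L_ge0 (P : {poly R}) : 0 <= L (P ^+ 2).
Proof. by rewrite -rho_horner; apply: Rintegral_ge0 => x _; rewrite horner_exp sqr_ge0. Qed.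

Let L_eps N : L (eps N ^+ 2) <= (q ^+ N) ^+ 2.
Proof.
elim: N => [|N ih].
  by rewrite /eps !expr0 !expr1n (_ : L 1 = 1)//; exact: bmoment1.
have -> : eps N.+1 = (C + t)^-1 *: (C%:P - 'X^2) * eps N by rewrite /eps exprS.
rewrite (le_trans (@bmoment_contraction R L C t (eps N) (ltW C0) t0 L_ge0 LC))//.
have -> : (q ^+ N.+1) ^+ 2 = q ^+ 2 * (q ^+ N) ^+ 2 by rewrite -exprMn -exprS.
by rewrite ler_wpM2l// sqr_ge0.
Qed.

Let P_ N : {poly R} := (C + t)^-1 *: \sum_(k < N) eps k.

Let P_E N : ('X^2 + t%:P) * P_ N = 1 - eps N.
Proof.
have Ct : C + t != 0 by rewrite gt_eqF// addr_gt0.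
rewrite /P_ /eps; set y := _ *: (C%:P - 'X^2).
rewrite -[RHS]opprB subrX1 -mulNr opprB -scalerAr scalerAl; congr (_ * _).
rewrite -[X in X - y](scale1r 1) -(mulVf Ct) -scalerA -scalerBr.
by congr (_ *: _); rewrite -mul_polyC polyCD mulr1; ring.
Qed.

Let weight_sqr x : `|f x ^+ 2 / (f x ^+ 2 + t)| <= 1.
Proof.
rewrite ger0_norm ?divr_ge0 ?sqr_ge0 ?(ltW (sqrDt_gt0 t0 _))//.
by rewrite ler_pdivrMr ?sqrDt_gt0// mul1r lerDl ltW.
Qed.

Let ler_half (a e : R) : 0 < e -> a <= e ^+ 2 -> (e + a / e) / 2 <= e.
Proof.
move=> e0 ae; have : a / e <= e by rewrite ler_pdivrMr// -expr2.
by lra.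
Qed.

Let q0 : 0 < q.
Proof. by rewrite divr_gt0// addr_gt0. Qed.

(** The weight [x^2 / (x^2 + t)] is at most 1, so only the quadratic norm of [tr (eps N)] under [E]
    matters; [bmoment_sqr_ge] bounds it by that of [eps N] under [L]. *)
Let A_eps N : `|A ('X^2 * tr (eps N))| <= q ^+ N.
Proof.
have qN : 0 < q ^+ N by rewrite exprn_gt0.
have -> : A ('X^2 * tr (eps N)) =
    \int[mu]_x ((tr (eps N)).[f x] * (f x ^+ 2 / (f x ^+ 2 + t))).
  by apply: eq_Rintegral => x _; rewrite hornerM hornerXn mulrAC mulrC.
apply: le_trans (Rintegral_weight_le qN _ _ _ weight_sqr) _.
- exact: integrable_horner.
- rewrite (_ : _ \o _ = EFin \o (fun x => (tr (eps N) ^+ 2).[f x])).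
    exact: integrable_horner.
  by apply/funext => x; rewrite /= horner_exp.
- apply: measurable_funM; last exact: measurable_resolvent.
  exact: measurable_funX.
apply: ler_half => //; apply: le_trans (L_eps N).
apply: le_trans (bmoment_sqr_ge E1 n0 E_ge0 (eps N)).
rewrite le_eqVlt; apply/orP; left; apply/eqP.
by apply: eq_Rintegral => x _; rewrite horner_exp.
Qed.

Let rho_eps N (w : R -> R) : measurable_fun setT w ->
  (forall x, `|w x| <= 1) -> `|\int[rho]_x ((eps N).[x] * w x)| <= q ^+ N.
Proof.
move=> mw w1; have qN : 0 < q ^+ N by rewrite exprn_gt0.
have i1 : rho.-integrable setT (EFin \o (fun x => (eps N).[x])).
  exact: (@integrable_horner _ _ _ rho id introh).
have i2 : rho.-integrable setT (EFin \o (fun x => (eps N).[x] ^+ 2)).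
  rewrite (_ : _ \o _ = EFin \o (fun x => (eps N ^+ 2).[x])).
    exact: (@integrable_horner _ _ _ rho id introh).
  by apply/funext => x; rewrite /= (horner_exp (eps N) x 2).
apply: (le_trans (@Rintegral_weight_le _ _ _ rho _ w _ qN i1 i2 mw w1)).
apply: ler_half => //; apply: le_trans (L_eps N).
rewrite -rho_horner le_eqVlt; apply/orP; left; apply/eqP.
by apply: eq_Rintegral => x _; rewrite (horner_exp (eps N) x 2).
Qed.

Let den_gt0 : 0 < 1 + n.-1%:R * theta.
Proof. by rewrite ltr_pwDl// mulr_ge0. Qed.

Let G := stieltjes rho id t.

Let mres : measurable_fun setT (fun x : measurableTypeR R => (x ^+ 2 + t)^-1).
Proof. exact: (@measurable_resolvent _ (measurableTypeR R) R id (@measurable_id _ _ _)). Qed.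

Let rho_P N : \int[rho]_x (P_ N).[x] + \int[rho]_x ((eps N).[x] * (x ^+ 2 + t)^-1) = G.
Proof.
rewrite -RintegralD//; last 2 first.
- exact: (@integrable_horner _ _ _ rho id introh).
- apply: (@integrable_weight _ _ _ rho _ _ t^-1).
  + exact: (@integrable_horner _ _ _ rho id introh).
  + exact: mres.
  + exact: (resolvent_le id t0).
apply: eq_Rintegral => x _.
have x0 : x ^+ 2 + t != 0 by rewrite gt_eqF// sqrDt_gt0.
apply: (mulfI x0); rewrite mulrDr mulrCA divff// mulr1.
have := congr1 (fun p => p.[x]) (P_E N).
by rewrite hornerM hornerD hornerXn hornerC hornerD hornerN hornerC => ->; rewrite subrK.
Qed.

(* [P_ N] is a partial sum of the expansion of [1 / ('X^2 + t)] in powers of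
   [C - 'X^2], with remainder [eps N / ('X^2 + t)]. *)
Let G_approx N : `|t * G - (1 - n%:R * beta * theta)| <= (2 + n%:R * beta) * q ^+ N.
Proof.
have L_eq : L (1 - eps N) = 1 - L (eps N).
  by rewrite raddfB; congr (_ - _); exact: bmoment1.
have A_eq : A ('X^2 * tr (1 - eps N)) = theta - A ('X^2 * tr (eps N)).
  have -> : tr (1 - eps N) = 1 - tr (eps N) by rewrite /tr raddfB; congr (_ - _); exact: btrans1.
  by rewrite mulrBr mulr1 raddfB; congr (_ - _).
have w1 x : `|t * (x ^+ 2 + t)^-1| <= 1.
  have x0 := sqrDt_gt0 t0 x.
  rewrite ger0_norm ?mulr_ge0 ?invr_ge0 ?(ltW t0) ?(ltW x0)//.
  by rewrite ler_pdivrMr// mul1r lerDr sqr_ge0.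
have mw : measurable_fun setT (fun x : measurableTypeR R => t * (x ^+ 2 + t)^-1).
  exact: measurable_funM.
have r1 := @rho_eps N (fun x => t * (x ^+ 2 + t)^-1) mw w1.
have r2 := @rho_eps N (cst 1) (measurable_cst _) (fun=> ltac:(by rewrite normr1)).
have r3 := A_eps N.
have D0 : 1 + n.-1%:R * (1 - t * A 1) != 0 by rewrite A1 gt_eqF.
have h := @bmoment_resolvent R E A n t (P_ N) n0 E1 AE AX D0.
rewrite P_E A1 in h.
have {}h : L (1 - eps N) - n%:R * beta * A ('X^2 * tr (1 - eps N)) = t * L (P_ N).
  exact: h.
rewrite A_eq L_eq in h.
have rE : \int[rho]_x ((eps N).[x] * (t * (x ^+ 2 + t)^-1)) =
    t * \int[rho]_x ((eps N).[x] * (x ^+ 2 + t)^-1).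
  under eq_Rintegral do rewrite mulrCA.
  rewrite RintegralZl//.
  apply: (@integrable_weight _ _ _ rho _ _ t^-1) => //.
  + exact: (@integrable_horner _ _ _ rho id introh).
  + exact: (resolvent_le id t0).
have rE2 : \int[rho]_x ((eps N).[x] * cst 1 x) = L (eps N).
  by rewrite -rho_horner; apply: eq_Rintegral => x _; rewrite mulr1.
rewrite rE in r1; rewrite rE2 in r2.
(* Two remainders come from [rho] and one from [A], the latter with factor [n beta]; hence the
   constant [2 + n beta]. *)
have -> : t * G - (1 - n%:R * beta * theta) =
    t * \int[rho]_x ((eps N).[x] * (x ^+ 2 + t)^-1) - L (eps N)
    + n%:R * beta * A ('X^2 * tr (eps N)).
  rewrite -(rho_P N) rho_horner mulrDr -[t * L _]h; ring.
have nb : 0 <= n%:R * beta by rewrite mulr_ge0// ltW.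
apply: le_trans (ler_normD _ _) _; rewrite mulrDl; apply: lerD.
  by rewrite (le_trans (ler_normB _ _))// mulrDl mul1r lerD.
by rewrite normrM (ger0_norm nb) ler_wpM2l.
Qed.

(** Additivity of the self-energy, cleared of denominators: with [g_S] the transform of [rho], it
    reads [1 / g_S - t = n (1 / g - t)]. The bound of [G_approx] holds for all [N] and tends to
    0. *)
Lemma stieltjes_bmoment :
  stieltjes rho id t * (n%:R - n.-1%:R * t * g) = g.
Proof.
have GE : t * G = 1 - n%:R * beta * theta.
  apply/eqP; rewrite -subr_eq0 -normr_le0.
  have q1 : `|q| < 1.
    by rewrite ger0_norm ?(ltW q0)// ltr_pdivrMr ?addr_gt0// mul1r ltrDl.
  have K : (2 + n%:R * beta) * q ^+ N @[N --> \oo] --> (2 + n%:R * beta) * 0.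
    by apply: cvgMr; exact: cvg_expr.
  rewrite mulr0 in K.
  by apply: (ler_cvg_to (cvg_cst _) K); exact: nearW.
have nE : n%:R = n.-1%:R + 1 :> R by rewrite -[in LHS](prednK n0) -natr1.
have dE : n%:R - n.-1%:R * t * g = 1 + n.-1%:R * theta by rewrite /theta nE; ring.
have tn0 : t != 0 by rewrite gt_eqF.
apply: (mulfI tn0).
rewrite -/G mulrA GE dE mulrBl mul1r mulrAC -[_ * beta * _]mulrA mulVf; last first.
  by rewrite gt_eqF.
by rewrite /theta nE; ring.
Qed.

End Resolvent.

Section AlmostEverywhere.
Context d (T : measurableType d) (R : realType) (P : probability T R).

Lemma Rintegral_ge0_eq0 (h : T -> R) : P.-integrable setT (EFin \o h) ->
  (forall x, 0 <= h x) -> \int[P]_x h x = 0 -> {ae P, forall x, h x = 0}.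
Proof.
move=> ih h0 Ih.
have : (\int[P]_x `|(h x)%:E| = 0)%E.
  under eq_integral do rewrite gee0_abs ?lee_fin//.
  by rewrite -[LHS]fineK ?integrable_fin_num// -/(Rintegral _ _ _) Ih.
move=> /(ae_eq_integral_abs P measurableT (measurable_int _ ih)).1.
by apply: filterS => x /(_ I)[].
Qed.

Lemma ae_exists (Q : T -> Prop) : {ae P, forall x, Q x} -> exists x, Q x.
Proof.
move=> PQ; apply: contrapT => nQ.
have : P.-negligible setT.
  by apply: negligibleS PQ => x _ /= Qx; apply: nQ; exists x.
move=> /negligibleP -/(_ measurableT) P0.
have := probability_setT P; rewrite P0 => -[] /eqP.
by rewrite eq_sym oner_eq0.
Qed.

Lemma Rintegral_gt0 (h : T -> R) : P.-integrable setT (EFin \o h) ->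
  (forall x, 0 < h x) -> 0 < \int[P]_x h x.
Proof.
move=> ih h0; rewrite lt_neqAle Rintegral_ge0 ?andbT//; last by move=> x _; exact: ltW.
apply/eqP => /esym /(Rintegral_ge0_eq0 ih (fun x => ltW (h0 x)))/ae_exists[x].
by move/eqP; rewrite gt_eqF.
Qed.

Lemma ae_imply (Q1 Q2 : T -> Prop) : (forall x, Q1 x -> Q2 x) ->
  {ae P, forall x, Q1 x} -> {ae P, forall x, Q2 x}.
Proof. by move=> Q12; apply: filterS. Qed.

Lemma Rintegral_ae_eq (g h : T -> R) : measurable_fun setT g -> measurable_fun setT h ->
  {ae P, forall x, g x = h x} -> \int[P]_x g x = \int[P]_x h x.
Proof.
move=> mg mh gh; congr fine; apply: ae_eq_integral => //.
- exact/measurable_EFinP.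
- exact/measurable_EFinP.
- by apply: filterS gh => x -> _.
Qed.

Lemma Rintegral_ae_ge0 (h : T -> R) : measurable_fun setT h ->
  {ae P, forall x, 0 <= h x} -> 0 <= \int[P]_x h x.
Proof.
move=> mh h0; rewrite (Rintegral_ae_eq (h := fun x => `|h x|) mh).
- by apply: Rintegral_ge0 => x _.
- exact: measurableT_comp.
- by apply: ae_imply h0 => x hx; rewrite ger0_norm.
Qed.

(** Markov's inequality for the power [2 k] bounds the mass beyond [K + 1] by [(K / (K + 1))^(2 k)];
    the margin 1 makes this tend to 0. *)
Lemma ae_bounded_moment (f : T -> R) (K : R) : measurable_fun setT f ->
  (forall k, P.-integrable setT (fun x => (f x ^+ k)%:E)) -> 0 <= K ->
  (forall k, \int[P]_x (f x ^+ (2 * k)) <= K ^+ (2 * k)) ->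
  {ae P, forall x, `|f x| <= K + 1}.
Proof.
move=> mf im K0 mK.
pose N : set T := (fun x => `|f x|) @^-1` `]K + 1, +oo[%classic.
have mN : measurable N.
  rewrite -[X in measurable X]setTI.
  by apply: (measurableT_comp (@normr_measurable R setT) mf).
exists N; split => //; last first.
  by move=> x /= /negP; rewrite -ltNge /N /= in_itv/= andbT.
have K1 : 0 < K + 1 by rewrite ltr_wpDl.
pose r := (K / (K + 1)) ^+ 2.
have r01 : `|r| < 1.
  have KK : K / (K + 1) < 1 by rewrite ltr_pdivrMr// mul1r ltrDl.
  have KK0 : 0 <= K / (K + 1) by rewrite divr_ge0// ltW.
  by rewrite ger0_norm ?sqr_ge0// /r; nra.
have PN k : fine (P N) <= r ^+ k.
  have a0 : 0 < (K + 1) ^+ (2 * k) by rewrite exprn_gt0.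
  have := le_integral_abse P measurableT (measurable_int _ (im (2 * k)%N)) a0.
  set N' := (X in (_ * P X)%E); have NN' : N `<=` N'.
    move=> x; rewrite /N /= in_itv/= andbT => Kx; split=> //=.
    by rewrite lee_fin normrX lerXn2r// ?nnegrE ?(ltW K1)// ltW.
  have mN' : measurable N'.
    apply: emeasurable_fun_c_infty => //.
    by apply: measurableT_comp => //; exact: measurable_int (im (2 * k)%N).
  have : (P N <= P N')%E by exact: le_measure (mem_set mN) (mem_set mN') NN'.
  have -> : (\int[P]_x `|(f x ^+ (2 * k))%:E| = (\int[P]_x (f x ^+ (2 * k)))%:E)%E.
    have f0 x : 0 <= f x ^+ (2 * k) by rewrite exprM exprn_ge0 ?sqr_ge0.
    under eq_integral do rewrite gee0_abs ?lee_fin//.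
    by rewrite fineK// integrable_fin_num.
  rewrite -[P N']fineK ?fin_num_measure// -[P N]fineK ?fin_num_measure//.
  rewrite -EFinM !lee_fin => h1 h2.
  rewrite /r -exprM expr_div_n ler_pdivlMr// mulrC.
  rewrite (le_trans _ (mK k))// (le_trans _ h2)// ler_wpM2l// ltW//.
have : fine (P N) <= 0.
  by apply: (ler_cvg_to (cvg_cst _) (cvg_expr r01)); exact: nearW.
move=> h; rewrite -[P N]fineK ?fin_num_measure//; congr EFin.
by apply/eqP; rewrite eq_le h fine_ge0.
Qed.

End AlmostEverywhere.

(** * Monotonicity of the self-energy *)

Section StieltjesMonotone.
Context d (T : measurableType d) (R : realType) (P : probability T R).
Variable f : T -> R.
Hypothesis mf : measurable_fun setT f.
Local Notation g := (stieltjes P f).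

Lemma integrable_stieltjes t : 0 < t ->
  P.-integrable setT (EFin \o (fun x => (f x ^+ 2 + t)^-1)).
Proof.
move=> t0; apply: (@integrable_weight1 _ _ _ P _ t^-1).
- exact: measurable_resolvent.
- by move=> x; exact: resolvent_le.
Qed.

Lemma stieltjes_gt0 t : 0 < t -> 0 < g t.
Proof.
move=> t0; apply: Rintegral_gt0; first exact: integrable_stieltjes.
by move=> x; rewrite invr_gt0 sqrDt_gt0.
Qed.

Lemma stieltjes_le t : 0 < t -> g t <= t^-1.
Proof.
move=> t0; rewrite -[leRHS](Rintegral_probability_cst P).
apply: le_Rintegral => //; first exact: integrable_stieltjes.
- exact: finite_measure_integrable_cst.
- move=> x _; rewrite lef_pV2 ?posrE ?sqrDt_gt0//.
  by rewrite lerDr sqr_ge0.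
Qed.

(* With [z = i sqrt t], [self_energy t] is [z K(z)] for the Boolean
   self-energy [K(z) = z - 1 / G(z)]. *)
Definition self_energy t := (g t)^-1 - t.

Lemma self_energy_ge0 t : 0 < t -> 0 <= self_energy t.
Proof.
move=> t0; rewrite subr_ge0 -[leLHS]invrK lef_pV2 ?posrE ?invr_gt0 ?stieltjes_gt0//.
exact: stieltjes_le.
Qed.

(* Jensen's inequality for [x^2 |-> 1 / (x^2 + s)] as a convex function of
   [1 / (x^2 + u)]: the integrand is the gap to the tangent at [x^2 = r]. *)
Lemma self_energy_mono s u : 0 < s -> s <= u ->
  self_energy s <= self_energy u /\
  (s < u -> self_energy s = self_energy u ->
    {ae P, forall x, f x ^+ 2 = self_energy u}).
Proof.
move=> s0 su; have u0 : 0 < u by exact: lt_le_trans su.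
set r := self_energy u.
have r0 : 0 <= r by exact: self_energy_ge0.
have rs : 0 < r + s by rewrite ltr_wpDl.
have ru : 0 < r + u by rewrite ltr_wpDl.
have gu : g u = (r + u)^-1 by rewrite /r /self_energy subrK invrK.
(* The slope at [x^2 = r] of [1 / (x^2 + s)] as a function of [1 / (x^2 + u)]. The tangency point is
   the mean: [r] is defined so that [g u = 1 / (r + u)]. *)
pose K := (r + u) ^+ 2 / (r + s) ^+ 2.
pose h x := (f x ^+ 2 + s)^-1 - (K * (f x ^+ 2 + u)^-1 + ((r + s)^-1 - K * (r + u)^-1)).
have hE x : h x = (f x ^+ 2 - r) ^+ 2 * (u - s) /
    ((r + s) ^+ 2 * (f x ^+ 2 + s) * (f x ^+ 2 + u)).
  by rewrite /h /K; field; rewrite !gt_eqF// sqrDt_gt0.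
have h0 x : 0 <= h x.
  rewrite hE divr_ge0//; first by rewrite mulr_ge0 ?sqr_ge0// subr_ge0.
  by rewrite !mulr_ge0 ?sqr_ge0// ltW// sqrDt_gt0.
have i1 : P.-integrable setT (EFin \o (fun x => K * (f x ^+ 2 + u)^-1)).
  exact: (integrableZl measurableT K (integrable_stieltjes u0)).
have i0 (a : R) : P.-integrable setT (EFin \o cst a).
  exact: finite_measure_integrable_cst.
have i2 a : P.-integrable setT (EFin \o (fun x => K * (f x ^+ 2 + u)^-1 + a)).
  exact: (integrableD measurableT i1 (i0 a)).
have ih : P.-integrable setT (EFin \o h).
  exact: (integrableB measurableT (integrable_stieltjes s0) (i2 _)).
have Ih : \int[P]_x h x = g s - (r + s)^-1.
  rewrite /h RintegralB//; last exact: integrable_stieltjes.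
  rewrite RintegralD//; last exact: i0.
  rewrite RintegralZl//; last exact: integrable_stieltjes.
  rewrite Rintegral_probability_cst -!/(stieltjes P f _) gu; ring.
have gs : (r + s)^-1 <= g s.
  by rewrite -subr_ge0 -Ih; apply: Rintegral_ge0 => x _.
split.
  rewrite /self_energy lerBlDr -[leRHS]invrK lef_pV2 ?posrE ?stieltjes_gt0//.
  by rewrite invr_gt0.
move=> lt_su es.
have : \int[P]_x h x = 0.
  rewrite Ih; apply/eqP; rewrite subr_eq0; apply/eqP.
  by rewrite -es /self_energy subrK invrK.
move=> /(Rintegral_ge0_eq0 ih h0); apply: filterS => x; rewrite hE => /eqP.
have den : 0 < (r + s) ^+ 2 * (f x ^+ 2 + s) * (f x ^+ 2 + u).
  by rewrite !mulr_gt0 ?exprn_gt0// sqrDt_gt0.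
rewrite mulf_eq0 invr_eq0 (gt_eqF den) orbF mulf_eq0 [u - s == 0]subr_eq0 (gt_eqF lt_su) orbF.
by rewrite sqrf_eq0 subr_eq0 => /eqP.
Qed.

Lemma stieltjes_ae_cst r t : 0 < t -> {ae P, forall x, f x ^+ 2 = r} ->
  g t = (r + t)^-1.
Proof.
move=> t0 fr; rewrite -[RHS](Rintegral_probability_cst P).
rewrite /g /Rintegral; congr fine; apply: ae_eq_integral => //.
- by apply/measurable_EFinP; exact: measurable_resolvent.
- by apply: filterS fr => x -> _.
Qed.

End StieltjesMonotone.

(** * The kernel of the Fisher information *)

Section Kernel.
Variable R : realType.
Local Notation leb := (@lebesgue_measure R).

Lemma integral_0y_derive (f F : R -> R) (l : R) :
  (forall t : R, 0 <= t -> 0 <= f t) ->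
  (forall t : R, 0 <= t -> {for t, continuous f}) ->
  (forall t : R, 0 <= t -> is_derive t 1 F (f t)) ->
  F t @[t --> +oo] --> l ->
  (\int[leb]_(t in `[0%R, +oo[) (f t)%:E = (l - F 0)%:E)%E.
Proof.
move=> f0 cf dF Fl.
rewrite (ge0_continuous_FTC2y f0 _ Fl) ?EFinB//.
- apply: continuous_in_subspaceT => t; rewrite inE/= in_itv/= andbT => t0; exact: cf.
- by move=> t /ltW/dF[].
- apply: cvg_at_right_filter.
  have [dF0 _] := dF 0 (lexx _).
  exact/differentiable_continuous/derivable1_diffP.
- move=> t; rewrite in_itv/= andbT => /ltW/dF[dFt Ft].
  by rewrite derive1E.
Qed.

Lemma is_derive_shift (a t : R) : is_derive t 1 (fun t : R => a + t) 1.
Proof. by have := is_deriveD (is_derive_cst a t 1) (is_derive_id t 1); rewrite add0r. Qed.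

Lemma continuous_shiftV (a t : R) : 0 < a + t -> {for t, continuous (fun t : R => (a + t)^-1)}.
Proof.
move=> at0; apply: continuousV; first by rewrite gt_eqF.
by apply: continuousD; [exact: cst_continuous|exact: cvg_id].
Qed.

Lemma cvg_shiftV (a : R) : 0 <= a -> (a + t)^-1 @[t --> +oo] --> (0 : R).
Proof.
move=> a0; apply/cvgrPdist_le => e e0; near=> t.
have t0 : 0 < t by near: t; exact: nbhs_pinfty_gt.
have at0 : 0 < a + t by rewrite ltr_wpDl.
rewrite sub0r normrN gtr0_norm ?invr_gt0// -[leRHS]invrK lef_pV2 ?posrE ?invr_gt0//.
apply: (@le_trans _ _ t); last by rewrite lerDr.
by near: t; apply: nbhs_pinfty_ge; rewrite num_real.
Unshelve. all: by end_near. Qed.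

Lemma integral_resolventM (a b : R) : 0 < a -> 0 < b ->
  (\int[leb]_(t in `[0%R, +oo[) ((a + t)^-1 * (b + t)^-1)%:E =
   (if a == b then a^-1 else (ln a - ln b) / (a - b))%:E)%E.
Proof.
move=> a0 b0.
have at0 (t : R) : 0 <= t -> 0 < a + t by move=> ?; rewrite ltr_pwDl.
have bt0 (t : R) : 0 <= t -> 0 < b + t by move=> ?; rewrite ltr_pwDl.
have f0 (t : R) : 0 <= t -> 0 <= (a + t)^-1 * (b + t)^-1.
  by move=> t0; rewrite mulr_ge0// invr_ge0 ltW// (at0, bt0).
have cf (t : R) : 0 <= t -> {for t, continuous (fun t : R => (a + t)^-1 * (b + t)^-1)}.
  by move=> t0; apply: continuousM; apply: continuous_shiftV; rewrite (at0, bt0).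
have [ab|ab] := eqVneq a b.
  have dF (t : R) : 0 <= t -> is_derive t 1 (fun t => - (a + t)^-1) ((a + t)^-1 * (b + t)^-1).
    move=> t0; rewrite -ab.
    have h := is_deriveN (is_deriveV (lt0r_neq0 (at0 t t0)) (is_derive_shift a t)).
    apply: is_derive_eq h _.
    by rewrite scaleNr opprK [_ *: _]mulr1 -expr2 exprVn.
  have Fl : - (a + t)^-1 @[t --> +oo] --> (0 : R).
    by rewrite -oppr0; apply: cvgN; apply: cvg_shiftV; exact: ltW.
  by rewrite (integral_0y_derive f0 cf dF Fl) addr0 sub0r opprK.
have ab0 : a - b != 0 by rewrite subr_eq0.
have dF (t : R) : 0 <= t -> is_derive t 1
    (fun t => (a - b)^-1 *: (ln (b + t) - ln (a + t))) ((a + t)^-1 * (b + t)^-1).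
  move=> t0.
  have h1 := is_derive1_comp (is_derive1_ln (bt0 t t0)) (is_derive_shift b t).
  have h2 := is_derive1_comp (is_derive1_ln (at0 t t0)) (is_derive_shift a t).
  have := is_deriveZ (a - b)^-1 (is_deriveB h1 h2).
  move=> h; apply: is_derive_eq h _; rewrite /GRing.scale/=.
  by field; rewrite ab0 !lt0r_neq0 ?at0 ?bt0.
have Fl : (a - b)^-1 *: (ln (b + t) - ln (a + t)) @[t --> +oo] --> (0 : R).
  rewrite -(scaler0 _ (a - b)^-1); apply: cvgZr.
  have c1 : 1 + (b - a) * (a + t)^-1 @[t --> +oo] --> 1 + (b - a) * 0.
    by apply: cvgD; [exact: cvg_cst|apply: cvgMr; apply: cvg_shiftV; exact: ltW].
  rewrite mulr0 addr0 in c1.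
  have := cvg_comp _ _ c1 (continuous_ln (ltr01 : 0 < 1 :> R)).
  rewrite ln1; apply: cvg_trans; apply: near_eq_cvg; near=> t.
  have t0 : 0 <= t by near: t; apply: nbhs_pinfty_ge; rewrite num_real.
  rewrite /= -ln_div ?posrE ?at0 ?bt0//; congr ln.
  by field; rewrite lt0r_neq0 ?at0.
rewrite (integral_0y_derive f0 cf dF Fl) !addr0 sub0r.
by rewrite -mulrN opprB mulrC.
Unshelve. all: by end_near. Qed.

Lemma inve_EFin (r : R) : r != 0 -> (r%:E^-1 = r^-1%:E)%E.
Proof. by move=> r0; rewrite inver (negbTE r0). Qed.

Lemma measurable_shiftV (a : R) : measurable_fun setT (fun t : R => (a + t)^-1).
Proof.
apply: (measurableT_comp (@measurable_inv R)).
exact: measurable_funD.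
Qed.

Lemma integral_resolvent0 (b : R) : 0 <= b ->
  (\int[leb]_(t in `]0%R, +oo[) (t^-1 * (b + t)^-1)%:E = +oo)%E.
Proof.
move=> b0; apply/eqyP => M M0.
(* The integrand is bounded below by one with positive parameters [a] and [b'], whose integral is
   explicit. For [b > 0], [ln b - ln a = M b] makes it [M / (1 - expR (- (M b)))]; for [b = 0],
   [a = b' = 1 / M] makes it exactly [M]. *)
pose a := if b == 0 then M^-1 else b * expR (- (M * b)).
pose b' := if b == 0 then M^-1 else b.
have b'_ge : b <= b' by rewrite /b'; case: eqP => // ->; rewrite invr_ge0 ltW.
have b'0 : 0 < b' by rewrite /b'; have [_|bn] := eqVneq b 0; rewrite ?invr_gt0// lt_neqAle eq_sym bn.
have a0 : 0 < a.
  rewrite /a; have [_|bn] := eqVneq b 0; first by rewrite invr_gt0.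
  by rewrite mulr_gt0 ?expR_gt0// lt_neqAle eq_sym bn.
apply: (@le_trans _ _ (\int[leb]_(t in `]0%R, +oo[) ((a + t)^-1 * (b' + t)^-1)%:E)%E).
  rewrite integral_itv_obnd_cbnd; last first.
    apply/measurable_EFinP/measurable_funTS; apply: measurable_funM; exact: measurable_shiftV.
  rewrite integral_resolventM// lee_fin /a /b'.
  have [_|bn] := eqVneq b 0; first by rewrite eqxx invrK.
  have bp : 0 < b by rewrite lt_neqAle eq_sym bn.
  have Mb : 0 < M * b by rewrite mulr_gt0.
  have e1 : expR (- (M * b)) < 1 by rewrite expR_lt1 oppr_lt0.
  have -> : (b * expR (- (M * b)) == b) = false.
    by apply/negbTE; rewrite -subr_eq0 -[X in _ - X]mulr1 -mulrBr mulf_neq0// subr_eq0 lt_eqF.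
  rewrite lnM ?posrE ?expR_gt0// expRK.
  have e1n : 1 - expR (- (M * b)) != 0 by rewrite subr_eq0 gt_eqF.
  have -> : (ln b - M * b - ln b) / (b * expR (- (M * b)) - b) = M / (1 - expR (- (M * b))).
    by field; rewrite e1n/= -[X in _ - X]mulr1 -mulrBr mulf_neq0// subr_eq0 lt_eqF.
  by rewrite ler_pdivlMr ?subr_gt0// ler_piMr ?(ltW M0)// gerBl expR_ge0.
apply: ge0_le_integral => //.
- move=> t; rewrite /= in_itv/= andbT => t0.
  by rewrite lee_fin mulr_ge0// invr_ge0 addr_ge0// ltW.
- by apply/measurable_EFinP/measurable_funTS; apply: measurable_funM; exact: measurable_shiftV.
- apply/measurable_EFinP/measurable_funTS; apply: measurable_funM; last exact: measurable_shiftV.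
  exact: measurable_inv.
- move=> t; rewrite /= in_itv/= andbT => t0; rewrite lee_fin.
  have bt : 0 < b + t by rewrite ltr_wpDl.
  apply: ler_pM; rewrite ?invr_ge0 ?addr_ge0 ?(ltW a0) ?(ltW t0) ?(ltW b'0)//.
    by rewrite lef_pV2 ?posrE ?addr_gt0// lerDr ltW.
  by rewrite lef_pV2 ?posrE ?bt ?addr_gt0// lerD2r.
Qed.

(** When [x] or [y] is 0 the integral diverges at [t = 0], in agreement with the conventions for
    [lne 0] and for the inverse of 0 in the kernel. *)
Lemma fisher_kernelE (x y : R) : (fisher_kernel x y =
  \int[leb]_(t in `]0%R, +oo[) ((x ^+ 2 + t)^-1 * (y ^+ 2 + t)^-1)%:E)%E.
Proof.
have sqr0 : (0 : R) ^+ 2 = 0 by rewrite expr0n.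
rewrite /fisher_kernel.
have [x0|x0] := eqVneq x 0.
  rewrite x0 sqr0; under [RHS]eq_integral do rewrite add0r.
  rewrite integral_resolvent0 ?sqr_ge0// le0_lneNy//.
  case: eqVneq => [_|y0]; first by rewrite inve0.
  have y2 : 0 < y ^+ 2 by rewrite lt_neqAle y0 sqr_ge0.
  rewrite lne_EFin// sub0r inve_EFin ?oppr_eq0 ?gt_eqF//= lt0_mulNye//.
  by rewrite lte_fin invr_lt0 oppr_lt0.
have x2 : 0 < x ^+ 2 by rewrite exprn_even_gt0.
have [y0|y0] := eqVneq y 0.
  rewrite y0 sqr0; under [RHS]eq_integral do rewrite mulrC add0r.
  rewrite integral_resolvent0 ?sqr_ge0// [lne 0]le0_lneNy//.
  by rewrite (gt_eqF x2) lne_EFin// subr0 inve_EFin ?gt_eqF//= gt0_mulye// lte_fin invr_gt0.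
have y2 : 0 < y ^+ 2 by rewrite exprn_even_gt0.
rewrite integral_itv_obnd_cbnd; last first.
  apply/measurable_EFinP/measurable_funTS; apply: measurable_funM; exact: measurable_shiftV.
rewrite integral_resolventM//; case: eqVneq => [_|xy].
  by rewrite inve_EFin// gt_eqF.
by rewrite !lne_EFin// -EFinB inve_EFin// subr_eq0.
Qed.

(** * The Fisher information as the integral of a squared transform *)

Section FisherStieltjes.
Variable rho : probability (measurableTypeR R) R.

(** The cutoff to [t > 0] sits inside the kernel, which is thereby nonnegative and jointly
    measurable on the whole plane, as Tonelli requires. *)
Let k (p : measurableTypeR R * measurableTypeR R) : R :=
  (p.1 ^+ 2 + p.2)^-1 * \1_(`]0%R, +oo[%classic) p.2.

Let k_ge0 p : 0 <= k p.
Proof.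
rewrite /k indicE; case: (boolP (p.2 \in _)) => [|_]; last by rewrite mulr0.
rewrite inE/= in_itv/= andbT mulr1 => p0.
by rewrite invr_ge0 addr_ge0 ?sqr_ge0// ltW.
Qed.

Let mk : measurable_fun setT k.
Proof.
apply: measurable_funM.
  apply: (measurableT_comp (@measurable_inv R)); apply: measurable_funD.
    by apply: measurable_funX; exact: measurable_fst.
  exact: measurable_snd.
have -> : (fun p : measurableTypeR R * measurableTypeR R =>
    \1_(`]0%R, +oo[%classic) p.2) = \1_(`]0%R, +oo[%classic : set R) \o snd :> (_ -> R) by [].
by apply: measurableT_comp; [exact: measurable_indic|exact: measurable_snd].
Qed.

Let kE x t : 0 < t -> k (x, t) = (x ^+ 2 + t)^-1.
Proof. by move=> t0; rewrite /k/= indicE mem_set ?mulr1//= in_itv/= t0. Qed.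

Let k0 x t : ~~ (0 < t) -> k (x, t) = 0.
Proof.
move=> t0; rewrite /k/= indicE memNset ?mulr0//= in_itv/= andbT.
exact/negP.
Qed.

Let S (t : measurableTypeR R) : \bar R := \int[rho]_x (k (x, t))%:E.

Let SE t : 0 < t -> S t = (stieltjes rho id t)%:E.
Proof.
move=> t0; rewrite /S /stieltjes /Rintegral fineK; last first.
  by apply: integrable_fin_num => //; exact: (@integrable_stieltjes _ _ _ rho id).
by apply: eq_integral => x _; rewrite kE.
Qed.

Let S_ge0 t : (0 <= S t)%E.
Proof. by apply: integral_ge0 => x _; rewrite lee_fin. Qed.

Let mS : measurable_fun setT S.
Proof.
apply: (@measurable_fun_fubini_tonelli_G _ _ _ _ _ rho (fun p => (k p)%:E)).
- exact/measurable_EFinP.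
- by move=> p; rewrite lee_fin.
Qed.

Lemma measurable_stieltjes_sqr :
  measurable_fun (`]0%R, +oo[%classic : set R) (fun t => (stieltjes rho id t ^+ 2)%:E).
Proof.
apply/measurable_EFinP/measurable_funX/measurable_EFinP.
have mS' : measurable_fun (`]0%R, +oo[%classic : set R) S by exact: measurable_funTS.
apply: eq_measurable_fun mS' => t; rewrite inE/= in_itv/= andbT => t0.
exact: SE.
Qed.

Lemma fisher_stieltjes :
  (\int[rho]_x \int[rho]_y fisher_kernel x y =
   \int[leb]_(t in `]0%R, +oo[) (stieltjes rho id t ^+ 2)%:E)%E.
Proof.
have kernE x y : (fisher_kernel x y = \int[leb]_t ((k (x, t))%:E * (k (y, t))%:E))%E.
  rewrite fisher_kernelE integral_mkcond; apply: eq_integral => t _.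
  rewrite patchE; case: ifPn => [|].
    by rewrite inE/= in_itv/= andbT => t0; rewrite !kE.
  rewrite notin_setE/= in_itv/= andbT => /negP t0.
  by rewrite !k0 ?mul0e.
have inner x : (\int[rho]_y fisher_kernel x y = \int[leb]_t ((k (x, t))%:E * S t))%E.
  under eq_integral do rewrite kernE.
  rewrite (fubini_tonelli (fun p => (k (x, p.2))%:E * (k p)%:E)%E)/=; last 2 first.
  - apply: emeasurable_funM; last exact/measurable_EFinP.
    apply/measurable_EFinP.
    apply: (measurableT_comp (f := fun t => k (x, t))); last exact: measurable_snd.
    exact: measurableT_comp mk (measurable_pair1 x).
  - by move=> p; rewrite mule_ge0// lee_fin.
  apply: eq_integral => t _; rewrite ge0_integralZl_EFin//.
  - by move=> y _; rewrite lee_fin.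
  - apply/measurable_EFinP; exact: measurableT_comp mk (measurable_pair2 t).
under eq_integral do rewrite inner.
rewrite (fubini_tonelli (fun p => (k p)%:E * S p.2)%E)/=; last 2 first.
- apply: emeasurable_funM; first exact/measurable_EFinP.
  by apply: (measurableT_comp mS); exact: measurable_snd.
- by move=> p; rewrite mule_ge0// lee_fin.
rewrite [RHS]integral_mkcond; apply: eq_integral => t _.
rewrite patchE; case: ifPn => [|].
  rewrite inE/= in_itv/= andbT => t0; rewrite SE//.
  rewrite ge0_integralZr//; last 3 first.
  - apply/measurable_EFinP; exact: measurableT_comp mk (measurable_pair2 t).
  - by move=> x _; rewrite lee_fin.
  - by rewrite lee_fin ltW// (@stieltjes_gt0 _ _ _ rho id).
  by rewrite -/(S t) SE// -EFinM expr2.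
rewrite notin_setE/= in_itv/= andbT => /negP t0.
by rewrite integral0_eq// => x _; rewrite k0 ?mul0e.
Qed.

End FisherStieltjes.

End Kernel.

(** * Operators and states *)

Section Operators.
Local Open Scope complex_scope.
Variables (R : realType) (H : completeNormedModType R[i]).
Implicit Types (A B : H -> H) (S : set (H -> H)).

Lemma bounded_operatorP A : bounded_operator A ->
  linear A /\ exists2 C : R[i], 0 <= C & forall x, `|A x| <= C * `|x|.
Proof.
move=> [linA [C AC]]; split=> //; exists `|C| => // x.
have Cx0 : 0 <= C * `|x| := le_trans (normr_ge0 _) (AC x).
by rewrite (le_trans (AC x))// -[leLHS]ger0_norm// normrM normr_id.
Qed.

Lemma bounded_operator_id : bounded_operator (idfun : H -> H).
Proof. by split=> //; exists 1 => x; rewrite mul1r. Qed.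

Lemma bounded_operator_comp A B :
  bounded_operator A -> bounded_operator B -> bounded_operator (A \o B).
Proof.
move=> /bounded_operatorP[lA [C C0 AC]] [lB [D BD]]; split.
  by move=> a u v; rewrite /= lB lA.
by exists (C * D) => x; rewrite /= (le_trans (AC _))// -mulrA ler_wpM2l.
Qed.

Lemma bounded_operator_lin (a : R[i]) A B :
  bounded_operator A -> bounded_operator B -> bounded_operator (a *: A + B).
Proof.
move=> [lA [C AC]] [lB [D BD]]; split.
  move=> b u v; rewrite !fctE lA lB !scalerDr !scalerA [a * b]mulrC.
  by rewrite addrACA.
exists (`|a| * C + D) => x; rewrite !fctE (le_trans (ler_normD _ _))// mulrDl lerD//.
by rewrite normrZ -mulrA ler_wpM2l.
Qed.

Section Commutant.
Variable S : set (H -> H).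
Hypothesis bS : S `<=` @bounded_operator R H.

Lemma commutant_id : commutant S idfun.
Proof. by split=> //; exact: bounded_operator_id. Qed.

Lemma commutant_comp A B : commutant S A -> commutant S B -> commutant S (A \o B).
Proof.
move=> [bA cA] [bB cB]; split; first exact: bounded_operator_comp.
by move=> C SC; rewrite -compA -cB// compA cA// -compA.
Qed.

Lemma commutant_lin (a : R[i]) A B :
  commutant S A -> commutant S B -> commutant S (a *: A + B).
Proof.
move=> [bA cA] [bB cB]; split; first exact: bounded_operator_lin.
move=> C SC; apply/funext => x; have [lC _] := bS SC.
have := congr1 (@^~ x) (cA C SC); have := congr1 (@^~ x) (cB C SC).
by rewrite /= !fctE lC => -> ->.
Qed.

End Commutant.

Section State.
Variables (M : set (H -> H)) (tau : (H -> H) -> R[i]).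
Hypothesis vM : M `<=` @bounded_operator R H.
Hypothesis M2 : commutant (commutant M) = M.
Hypothesis tau_lin : forall (c : R[i]) A B, M A -> M B ->
  tau (c *: A + B) = c * tau A + tau B.
Hypothesis tau1 : tau idfun = 1.

Let bM' : commutant M `<=` @bounded_operator R H.
Proof. by move=> A []. Qed.

(** [M] is the commutant of its commutant; its closure under the operations below comes from that of
    commutants. *)
Lemma vna_id : M idfun.
Proof. by rewrite -M2; exact: commutant_id. Qed.

Lemma vna_comp A B : M A -> M B -> M (A \o B).
Proof. by rewrite -M2; exact: commutant_comp. Qed.

Lemma vna_lin (a : R[i]) A B : M A -> M B -> M (a *: A + B).
Proof. by rewrite -M2; exact: commutant_lin. Qed.

Lemma vna_0 : M 0.
Proof.
have -> : 0 = -1 *: idfun + idfun :> (H -> H) by rewrite scaleN1r addNr.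
by apply: vna_lin; exact: vna_id.
Qed.

Lemma vna_scale (a : R[i]) A : M A -> M (a *: A).
Proof. by move=> MA; rewrite -[_ *: _]addr0; apply: vna_lin => //; exact: vna_0. Qed.

Lemma vna_sum (n : nat) (A : nat -> H -> H) :
  (forall i, (i < n)%N -> M (A i)) -> M (\sum_(i < n) A i).
Proof.
elim: n => [|n ih] MA; first by rewrite big_ord0; exact: vna_0.
rewrite big_ord_recr/= addrC -[A n]scale1r; apply: vna_lin; first exact: MA.
by apply: ih => i /ltnW; exact: MA.
Qed.

Lemma vna_iter k A : M A -> M (iter k A).
Proof.
move=> MA; elim: k => [|k ih]; first exact: vna_id.
rewrite (_ : iter k.+1 A = A \o iter k A); last by apply/funext.
exact: vna_comp.
Qed.

Lemma vna_linear A : M A -> linear A.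
Proof. by move=> /vM[]. Qed.

Lemma state_0 : tau 0 = 0.
Proof.
have := tau_lin (-1) vna_0 vna_0.
by rewrite scaleN1r oppr0 addr0 mulN1r addNr.
Qed.

Lemma state_scale c A : M A -> tau (c *: A) = c * tau A.
Proof.
by move=> MA; rewrite -[_ *: _]addr0 (tau_lin _ MA vna_0) state_0 addr0.
Qed.

Lemma state_sum (n : nat) (A : nat -> H -> H) :
  (forall i, (i < n)%N -> M (A i)) -> tau (\sum_(i < n) A i) = \sum_(i < n) tau (A i).
Proof.
elim: n => [|n ih] MA; first by rewrite !big_ord0 state_0.
rewrite !big_ord_recr/= addrC -[A n]scale1r tau_lin; last 2 first.
- exact: MA.
- by apply: vna_sum => i /ltnW; exact: MA.
rewrite scale1r mul1r addrC ih// => i /ltnW; exact: MA.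
Qed.

End State.

Lemma linear_comp_sum A (n : nat) (c : R[i]) (B : nat -> H -> H) : linear A ->
  A \o (c *: \sum_(i < n) B i) = c *: \sum_(i < n) (A \o B i).
Proof.
move=> lA; pose A' : {linear H -> H} := HB.pack A (GRing.isLinear.Build _ _ _ _ _ lA).
apply/funext => x; rewrite /= !fctE -[A _]/(A' _) linearZ/=; congr (_ *: _).
rewrite !fct_sumE -[LHS]/(A' _) raddf_sum; exact: eq_bigr.
Qed.

Section Moments.
Variable dot : {dot H for Num.conj}.
Variables (M : set (H -> H)) (tau : (H -> H) -> R[i]).
Hypothesis hilb : hilbert dot.
Hypothesis vM : M `<=` @bounded_operator R H.
Hypothesis M2 : commutant (commutant M) = M.
Hypothesis tau_lin : forall (c : R[i]) A B, M A -> M B ->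
  tau (c *: A + B) = c * tau A + tau B.
Hypothesis tau_ge0 : forall A, M A -> pos_operator dot A -> 0 <= tau A.
Hypothesis tau1 : tau idfun = 1.

Lemma selfadjoint_iter A k : selfadjoint dot A -> selfadjoint dot (iter k A).
Proof.
move=> sA; elim: k => [|k ih] x y //=.
by rewrite sA ih -iterS iterSr.
Qed.

(** With [K] a bound for the norm of [A], the operator [K^2 A^(2k) - A^(2k+2)] is positive, as its
    quadratic form at [x] is [K^2 |A^k x|^2 - |A^(k+1) x|^2]. *)
Lemma even_moment_le A : M A -> selfadjoint dot A ->
  exists2 K : R, 0 <= K & forall (m : nat -> R),
    (forall k, tau (iter k A) = (m k)%:C) -> forall k, m (2 * k)%N <= K ^+ (2 * k).
Proof.
move=> MA sA; have [lA [C C0 AC]] := bounded_operatorP (vM MA).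
have [K CE] := complex_realP _ (ger0_real C0).
exists K; first by rewrite -ler0c -CE.
move=> m mE; elim=> [|k ih].
  by rewrite muln0 expr0 -lecR -mE /= tau1.
pose B := (K ^+ 2)%:C *: iter (2 * k) A + (-1) *: iter (2 * k.+1) A.
have MB : M B.
  apply: vna_lin => //; first exact: vna_iter.
  by apply: (vna_scale M2); exact: vna_iter.
have dotE (a : R[i]) (U V : H -> H) x :
    dot ((a *: U + (-1) *: V) x) x = a * dot (U x) x - dot (V x) x.
  by rewrite !fctE linearDl /= !linearZl_LR/= mulN1r.
have posB : pos_operator dot B.
  move=> x; rewrite /B dotE subr_ge0.
  have it j y : dot (iter (2 * j) A y) y = `|iter j A y| ^+ 2.
    by rewrite hilb mul2n -addnn iterD (selfadjoint_iter _ sA).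
  rewrite !it rmorphXn/= -CE -exprMn.
  by rewrite lerXn2r ?nnegrE ?mulr_ge0.
have := tau_ge0 MB posB; rewrite /B tau_lin//; last 2 first.
- exact: vna_iter.
- by apply: (vna_scale M2); exact: vna_iter.
rewrite (state_scale M2 tau_lin)//; last exact: vna_iter.
rewrite !mE mulN1r -rmorphM subr_ge0 lecR => /le_trans; apply.
by rewrite mulnS exprD ler_wpM2l// sqr_ge0.
Qed.

End Moments.

(** * Words in Boolean independent variables *)

Section BooleanSum.
Variables (M : set (H -> H)) (tau : (H -> H) -> R[i]).
Hypothesis vM : M `<=` @bounded_operator R H.
Hypothesis M2 : commutant (commutant M) = M.
Hypothesis tau_lin : forall (c : R[i]) A B, M A -> M B ->
  tau (c *: A + B) = c * tau A + tau B.
Hypothesis tau1 : tau idfun = 1.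
Variable X : nat -> H -> H.
Hypothesis MX : forall i, M (X i).
Hypothesis Xind : boolean_independent tau X.
Variables (E : {scalar {poly R}}) (c : R) (n : nat).
Hypothesis n0 : (0 < n)%N.
Hypothesis XE : forall i k, (c ^+ k)%:C * tau (iter k (X i)) = (E 'X^k)%:C.

Let S : H -> H := c%:C *: \sum_(i < n) X i.
Let W (s : seq (nat * nat)) := \big[comp/idfun]_(p <- s) iter p.2 (X p.1).

Let MS : M S.
Proof. by apply: (vna_scale M2); exact: (vna_sum M2). Qed.

Let MW s : M (W s).
Proof.
elim: s => [|p s ih]; first by rewrite /W big_nil; exact: vna_id.
by rewrite /W big_cons; apply: vna_comp => //; exact: vna_iter.
Qed.

Let ES : E 1 = 1.
Proof. by apply: complexI; have := XE 0 0; rewrite !expr0 /= tau1 mulr1. Qed.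

Let tau_iterS k (A : H -> H) : M A ->
  tau (iter k.+1 S \o A) = c%:C * \sum_(h < n) tau (iter k S \o (X h \o A)).
Proof.
move=> MA.
have -> : iter k.+1 S \o A = (iter k S \o S) \o A.
  by apply/funext => x; rewrite /= -iterSr.
have MkS : M (iter k S) by exact: vna_iter.
rewrite /S linear_comp_sum; last exact: vna_linear MkS.
have -> : (c%:C *: \sum_(i < n) (iter k S \o X i)) \o A =
    c%:C *: \sum_(i < n) (iter k S \o (X i \o A)).
  by apply/funext => x; rewrite /= !fctE !fct_sumE.
have MkSX i : M (iter k S \o (X i \o A)) by do !apply: vna_comp => //.
rewrite (state_scale M2 tau_lin)//; last exact: (vna_sum M2 (A := fun i => iter k S \o (X i \o A))).
by rewrite (state_sum M2 tau_lin (A := fun i => iter k S \o (X i \o A))).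
Qed.

(* The letter [X_h] next to [X_i^j] either prolongs the run or, for [h != i],
   starts a new one. *)
Let boolean_word k i j s : (i < n)%N -> (0 < j)%N ->
  all (fun p => 0 < p.2)%N s -> sorted (fun p q => p.1 != q.1) ((i, j) :: s) ->
  (c ^+ j)%:C * tau (iter k S \o W ((i, j) :: s)) =
  (E ('X^j * bpoly E n k))%:C * \prod_(p <- s) tau (iter p.2 (X p.1)).
Proof.
elim: k i j s => [|k ih] i j s ltin j0 s0 sorted_s.
  rewrite (_ : iter 0 S \o _ = W ((i, j) :: s)); last exact/funext.
  by rewrite Xind//= ?j0// big_cons mulrA XE/= mulr1.
rewrite tau_iterS//.
have same : (c ^+ j)%:C * (c%:C * tau (iter k S \o (X i \o W ((i, j) :: s)))) =
    (E ('X^(j.+1) * bpoly E n k))%:C * \prod_(p <- s) tau (iter p.2 (X p.1)).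
  rewrite -(ih i)//; last by move: sorted_s; clear; case: s.
  rewrite exprSr rmorphM/= -mulrA; congr (_ * (_ * tau (_ \o _))).
  by rewrite /W !big_cons.
have other h : (h < n)%N -> h != i ->
    (c ^+ j)%:C * (c%:C * tau (iter k S \o (X h \o W ((i, j) :: s)))) =
    (E ('X * bpoly E n k) * E 'X^j)%:C * \prod_(p <- s) tau (iter p.2 (X p.1)).
  move=> hn hi; have := ih h 1%N ((i, j) :: s) hn isT.
  rewrite /= j0 s0 hi => /(_ isT sorted_s).
  rewrite expr1 {1}/W big_cons/= -/(W _) => ->; rewrite big_cons/=.
  by rewrite mulrCA [_ * (tau _ * _)]mulrA XE expr1 rmorphM/= mulrA.
set Pi := \prod_(p <- s) _ in same other *.
rewrite mulr_sumr mulr_sumr (bigD1 (Ordinal ltin))//= same.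
rewrite (eq_bigr (fun=> (E ('X * bpoly E n k) * E 'X^j)%:C * Pi)); last first.
  by move=> h hi; exact: (other h (ltn_ord h) hi).
rewrite sumr_const cardC1 card_ord -mulrnAl -mulrDl; congr (_ * _).
rewrite -[_ *+ _]mulr_natr -(rmorph_nat (real_complex R)) -rmorphM -rmorphD.
congr (_%:C); rewrite mulrDr linearD/= mulrA -exprSr; congr (_ + _).
by rewrite [_ * _%:P]mulrC mul_polyC linearZ/= mulrC mulrA.
Qed.

(** The rightmost letter of [S^(k+1)] can be any of [n], with equal contributions; [n = 1 + n.-1]
    then matches the recursion of [bpoly]. *)
Lemma boolean_sum_moment k : tau (iter k S) = (E (bpoly E n k))%:C.
Proof.
case: k => [|k]; first by rewrite /= ES tau1.
have -> : iter k.+1 S = iter k.+1 S \o idfun by apply/funext.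
rewrite tau_iterS; last exact: vna_id.
rewrite mulr_sumr (eq_bigr (fun=> (E ('X * bpoly E n k))%:C)); last first.
  move=> h _; have := @boolean_word k h 1 [::] (ltn_ord h) isT isT isT.
  rewrite !expr1 big_nil mulr1 => <-; congr (_ * tau (_ \o _)).
  by rewrite /W big_cons big_nil.
rewrite sumr_const card_ord /= linearD/= scalar_polyC// -[in RHS](mul1r (E ('X * _))).
rewrite mulrA mulr1 -mulrDl addrC natr1 prednK// mulr_natl.
by rewrite raddfMn.
Qed.

End BooleanSum.

End Operators.

(** * Fisher information of Boolean sums *)

Section SymmetricLaws.
Variable R : realType.
Implicit Types mu : probability (measurableTypeR R) R.

Lemma symmetric_odd mu (f : R -> R) : symmetric_law mu ->
  mu.-integrable setT (EFin \o f) -> (forall x, f (- x) = - f x) -> \int[mu]_x f x = 0.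
Proof.
move=> symmu intf oddf.
pose opp (x : measurableTypeR R) : measurableTypeR R := - x.
have mopp : measurable_fun setT opp by exact: oppr_measurable.
have oppE : (EFin \o f) \o opp = EFin \o (fun x => - f x).
  by apply/funext => x; rewrite /= oddf.
have intN : mu.-integrable (opp @^-1` setT) ((EFin \o f) \o opp).
  rewrite preimage_setT oppE (_ : _ \o _ = fun x => (- (EFin \o f) x)%E)//.
  exact: integrableN.
have := integral_pushforward mopp (measurable_int _ intf) intN measurableT.
rewrite preimage_setT oppE (eq_measure_integral mu); last by move=> A mA _; exact: symmu.
move=> /(congr1 fine); rewrite -!/(Rintegral _ _ _) => If.
have : \int[mu]_x (- f x) = - \int[mu]_x f x.
  under eq_Rintegral do rewrite -mulN1r.
  by rewrite RintegralZl// mulN1r.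
by rewrite -If => h; lra.
Qed.

(** Symmetry and the value of [x^2] determine every moment. Since [has_law] refers to moments only,
    this is how [mu] is compared with a two-point law. *)
Lemma symmetric_sqr_moment mu (r : R) (k : nat) : symmetric_law mu ->
  {ae mu, forall x, x ^+ 2 = r} ->
  mu.-integrable setT (fun x => (x ^+ k)%:E) /\
  \int[mu]_x (x ^+ k) = if odd k then 0 else r ^+ k./2.
Proof.
move=> symmu mur.
have r0 : 0 <= r by have [x <-] := ae_exists mur; exact: sqr_ge0.
have mX : measurable_fun setT (fun x : measurableTypeR R => x ^+ k).
  exact: measurable_funX.
have normX : {ae mu, forall x : measurableTypeR R, `|x ^+ k| = Num.sqrt r ^+ k}.
  by apply: ae_imply mur => x <-; rewrite sqrtr_sqr normrX.
have ik : mu.-integrable setT (EFin \o (fun x : measurableTypeR R => x ^+ k)).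
  apply/integrableP; split; first exact/measurable_EFinP.
  rewrite (ae_eq_integral (cst (Num.sqrt r ^+ k)%:E))//.
  - rewrite integral_cst// ltey_eq fin_numM//; exact: fin_num_measure.
  - by apply: measurableT_comp => //; exact/measurable_EFinP.
  - apply: ae_imply normX => x hx _ /=; by rewrite hx.
split=> //; case: ifPn => oddk.
  by apply: symmetric_odd => // x; rewrite exprNn -signr_odd oddk expr1 mulN1r.
rewrite (@Rintegral_ae_eq _ _ _ mu _ (cst (r ^+ k./2)))//.
  exact: Rintegral_probability_cst.
apply: ae_imply mur => x <-; rewrite -exprM mul2n even_halfK//.
Qed.

Lemma measurable_sqr_neq (r : R) : measurable [set x : measurableTypeR R | x ^+ 2 != r].
Proof.
rewrite -[X in measurable X]setTI (_ : [set x : R | _] = (fun x : R => x ^+ 2) @^-1` (~` [set r])).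
  by apply: measurable_funX => //; exact: measurableC.
by apply/seteqP; split=> x /= /eqP.
Qed.

Lemma two_pointE (a : R) (A : set (measurableTypeR R)) :
  two_point a A = ((2^-1)%:E * ((- a)%R \in A)%:R%:E + (2^-1)%:E * (a \in A)%:R%:E)%E.
Proof. by rewrite /two_point measure_addE /= /mscale /= !diracE. Qed.

Lemma two_point_sqr (a : R) : {ae two_point a, forall x, x ^+ 2 = a ^+ 2}.
Proof.
exists [set x : measurableTypeR R | x ^+ 2 != a ^+ 2]; split.
- exact: measurable_sqr_neq.
- apply: etrans (two_pointE _ _) _.
  by rewrite !memNset ?mule0 ?adde0//=; apply/negP; rewrite negbK// sqrrN.
- by move=> x /= /eqP.
Qed.

Lemma two_point_symmetric (a : R) : symmetric_law (two_point a).
Proof.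
move=> A mA; apply: etrans (two_pointE _ _) _; apply: esym.
apply: etrans (two_pointE _ _) _; rewrite addeC.
have memE x : (x \in (fun x => - x) @^-1` A) = (- x \in A).
  by apply/idP/idP => /set_mem h; exact: mem_set.
by rewrite !memE opprK.
Qed.

End SymmetricLaws.

Lemma has_law_law (R : realType) (H : completeNormedModType R[i])
    (tau : (H -> H) -> R[i]) (A : H -> H) :
  (exists mu, has_law tau A mu) -> has_law tau A (law tau A).
Proof. by move=> h; rewrite /law; case: pselect => // h'; exact: (projT2 (cid h')). Qed.

(** In terms of the self-energy, multiplication by [c] turns its value at [n t] into [n^-1] times
    that value at [t]. *)
Lemma stieltjes_scale (R : realType) (mu : probability (measurableTypeR R) R) (c t n : R) :
  0 < n -> 0 < t -> c ^+ 2 = n^-1 ->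
  stieltjes mu (fun x => c * x) t = n * stieltjes mu id (n * t).
Proof.
move=> n0 t0 cn; have nt0 : 0 < n * t by rewrite mulr_gt0.
rewrite /stieltjes -RintegralZl//; last first.
  exact: (@integrable_stieltjes _ _ _ mu id).
apply: eq_Rintegral => x _; rewrite exprMn cn.
have h1 : n^-1 * x ^+ 2 + t != 0.
  by rewrite gt_eqF// ltr_wpDl// mulr_ge0 ?sqr_ge0// invr_ge0 ltW.
have h2 : x ^+ 2 + n * t != 0 by rewrite gt_eqF// ltr_wpDl// sqr_ge0.
by field; rewrite h2 gt_eqF//= mulrC.
Qed.

Section BooleanSums.
Variables (R : realType) (H : completeNormedModType R[i]).
Variables (dot : {dot H for Num.conj}) (M : set (H -> H)) (tau : (H -> H) -> R[i]).
Variables (X : nat -> H -> H) (mu : probability (measurableTypeR R) R).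
Hypothesis HM : nc_probability_space dot M tau.
Hypothesis XM : forall i, M (X i).
Hypothesis Xsa : forall i, selfadjoint dot (X i).
Hypothesis Xind : boolean_independent tau X.
Hypothesis Xlaw : forall i, has_law tau (X i) mu.
Hypothesis musym : symmetric_law mu.

Let intmu k : mu.-integrable setT (fun x => (x ^+ k)%:E).
Proof. exact: (Xlaw 0%N k).1. Qed.

(** [has_law] provides moments only; the norm of [X 0] limits their growth, and this confines [mu]
    to a bounded set. *)
Let mu_bounded : exists2 K : R, 0 <= K & {ae mu, forall x, `|x| <= K}.
Proof.
case: HM => hilb [vM adj M2] [tau_lin tau_ge0 tau1] _ _.
have [K K0 hK] := even_moment_le hilb vM M2 tau_lin tau_ge0 tau1 (XM 0) (Xsa 0).
exists (K + 1); first by rewrite addr_ge0.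
apply: (@ae_bounded_moment _ _ _ mu id) => //.
by move=> k; apply: (hK (fun k => \int[mu]_x (x ^+ k))) => j; exact: (Xlaw 0%N j).2.
Qed.

Let S n : H -> H := ((Num.sqrt (n%:R : R))^-1)%:C%C *: \sum_(i < n) X i.

Lemma boolean_sum_stieltjes n : (0 < n)%N -> forall t, 0 < t ->
  stieltjes (law tau (S n)) id t = (t + self_energy mu id (n%:R * t))^-1.
Proof.
move=> n0; pose c : R := (Num.sqrt n%:R)^-1.
have nR0 : 0 < n%:R :> R by rewrite ltr0n.
have cn : c ^+ 2 = n%:R^-1 by rewrite exprVn sqr_sqrtr// ler0n.
(* The function [f] over [mu] plays the role of [X_i / sqrt n]. *)
pose f (x : measurableTypeR R) : R := c * x.
have intf k : mu.-integrable setT (fun x => (f x ^+ k)%:E).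
  rewrite (_ : (fun _ => _) = fun x => ((c ^+ k)%:E * (x ^+ k)%:E)%E).
    exact: integrableZl.
  by apply/funext => x; rewrite /f exprMn EFinM.
have mf : measurable_fun setT f by exact: measurable_funM.
pose E := moment_functional intf.
have EE q : E q = \int[mu]_x q.[f x] by [].
have EXn k : E 'X^k = c ^+ k * \int[mu]_x (x ^+ k).
  rewrite EE -RintegralZl//; last exact: intmu.
  apply: eq_Rintegral => x _.
  by rewrite hornerXn /f exprMn.
have E1 : E 1 = 1.
  by rewrite -(expr0 'X) EXn mul1r; under eq_Rintegral do rewrite expr0;
    exact: Rintegral_probability_cst.
have E_ge0 (P : {poly R}) : 0 <= E (P ^+ 2).
  by rewrite EE; apply: Rintegral_ge0 => x _; rewrite horner_exp sqr_ge0.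
have [K K0 muK] := mu_bounded.
have EK (P : {poly R}) : E ('X^2 * P ^+ 2) <= (c * K) ^+ 2 * E (P ^+ 2).
  rewrite -subr_ge0.
  have -> : (c * K) ^+ 2 * E (P ^+ 2) - E ('X^2 * P ^+ 2) =
      E ((((c * K) ^+ 2)%:P - 'X^2) * P ^+ 2).
    rewrite mulrBl raddfB mul_polyC; congr (_ - _); apply: esym.
    exact: linearZ.
  rewrite EE; apply: Rintegral_ae_ge0.
    by apply/measurable_EFinP; exact: (measurable_int _ (integrable_horner intf _)).
  apply: ae_imply muK => x xK; rewrite hornerM hornerD hornerN hornerC hornerXn horner_exp.
  rewrite mulr_ge0 ?sqr_ge0// subr_ge0 /f !exprMn ler_wpM2l ?sqr_ge0//.
  by rewrite -(real_normK (num_real x)) lerXn2r// ?nnegrE.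
pose L : {scalar {poly R}} := bmoment E n.
have L1 : L 1 = 1 by exact: bmoment1.
have L_ge0 (P : {poly R}) : 0 <= L (P ^+ 2) by exact: bmoment_sqr_ge0.
(* The summand 1 keeps [C] positive when [K = 0], as the geometric series requires. *)
pose C := n%:R ^+ 2 * (c * K) ^+ 2 + 1.
have C0 : 0 < C by rewrite ltr_wpDl// mulr_ge0 ?sqr_ge0.
have LC (P : {poly R}) : L ('X^2 * P ^+ 2) <= C * L (P ^+ 2).
  have := bmoment_bounded E1 n0 E_ge0 EK (sqr_ge0 _) P.
  rewrite -/(L _) -/(L (P ^+ 2)) => /le_trans; apply.
  by rewrite ler_wpM2r ?L_ge0// /C lerDl.
have tauS k : tau (iter k (S n)) = (L 'X^k)%:C%C.
  case: HM => hilb [vM adj M2] [tau_lin tau_ge0 tau1] _ _.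
  have -> : L 'X^k = E (bpoly E n k) by rewrite -btransXn.
  apply: (boolean_sum_moment vM M2 tau_lin tau1 XM Xind n0) => i j.
  by rewrite (Xlaw i j).2 EXn rmorphM.
have [P Pm] := bounded_moments L1 L_ge0 (ltW C0) LC.
(* The moments of [S n] belong to some law, so that [law] is not its default value, the Dirac mass
   at 0. *)
have lawS : has_law tau (S n) (law tau (S n)).
  apply: has_law_law; exists P => k; have [h1 h2] := Pm k.
  by split => //; rewrite tauS h2.
set rho := law tau (S n) in lawS *.
have introh k : rho.-integrable setT (fun x => (x ^+ k)%:E) by exact: (lawS k).1.
have rhoE k : \int[rho]_x (x ^+ k) = L 'X^k.
  by apply: complexI; rewrite -tauS (lawS k).2.
move=> t t0; have nt0 : 0 < n%:R * t by rewrite mulr_gt0.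
have odd0 : \int[mu]_x (f x / (f x ^+ 2 + t)) = 0.
  apply: symmetric_odd => //.
    have := integrable_resolvent mf intf t0 'X.
    by under eq_fun do rewrite hornerX.
  by move=> x; rewrite /f mulrN sqrrN mulNr.
have := @stieltjes_bmoment _ _ R mu f mf intf t t0 odd0 n n0 rho introh rhoE C C0 LC.
rewrite (stieltjes_scale _ nR0 t0 cn) /self_energy.
have := @stieltjes_gt0 _ _ _ mu id (@measurable_id _ _ _) _ nt0.
move: (stieltjes mu id (n%:R * t)) => g g0 GE.
have nE : n%:R = n.-1%:R + 1 :> R by rewrite -[in LHS](prednK n0) -natr1.
have {}GE : stieltjes rho id t * (1 - n.-1%:R * t * g) = g.
  apply: (mulfI (lt0r_neq0 nR0)); rewrite -[RHS]GE; ring.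
have d0 : 1 - n.-1%:R * t * g != 0.
  by apply/eqP => d0; move: GE; rewrite d0 mulr0 => /eqP; rewrite lt_eqF.
have -> : stieltjes rho id t = g / (1 - n.-1%:R * t * g) by apply: (mulIf d0); rewrite GE divfK.
rewrite nE; field; rewrite gt_eqF//=.
by rewrite [X in X != 0](_ : _ = 1 - n.-1%:R * t * g)//; ring.
Qed.

Local Notation Psi n := (boolean_fisher_information tau (S n)).
Local Notation se := (self_energy mu id).
Local Notation leb := (@lebesgue_measure R).
Let h (n : nat) (t : R) : R := (t + se (n%:R * t))^-1.

Let fisherE n : (0 < n)%N ->
  Psi n = (\int[leb]_(t in `]0%R, +oo[) (h n t ^+ 2)%:E)%E.
Proof.
move=> n0; rewrite /boolean_fisher_information fisher_stieltjes.
apply: eq_integral => t; rewrite inE/= in_itv/= andbT => t0.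
by rewrite boolean_sum_stieltjes.
Qed.

Let measurable_h n : (0 < n)%N ->
  measurable_fun (`]0%R, +oo[%classic : set R) (fun t => (h n t ^+ 2)%:E).
Proof.
move=> n0; apply: eq_measurable_fun (measurable_stieltjes_sqr (law tau (S n))) => t.
by rewrite inE/= in_itv/= andbT => t0; rewrite boolean_sum_stieltjes.
Qed.

Let mid : measurable_fun setT (id : measurableTypeR R -> R) := @measurable_id _ _ _.

Let scale_le (m n : nat) (t : R) : (m <= n)%N -> 0 < t -> m%:R * t <= n%:R * t.
Proof. by move=> mn t0; rewrite ler_pM2r// ler_nat. Qed.

Let h_gt0 n (t : R) : (0 < n)%N -> 0 < t -> 0 < h n t.
Proof.
move=> n0 t0; rewrite invr_gt0 ltr_pwDl//.
by rewrite (self_energy_ge0 mu mid)// mulr_gt0// ltr0n.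
Qed.

Let h_le m n (t : R) : (0 < m)%N -> (m <= n)%N -> 0 < t -> h n t <= h m t.
Proof.
move=> m0 mn t0; have n0 := leq_trans m0 mn.
have den_gt0 k : (0 < k)%N -> 0 < t + se (k%:R * t).
  by move=> k0; rewrite -invr_gt0 h_gt0.
rewrite /h lef_pV2 ?posrE ?den_gt0// lerD2l.
by apply: (self_energy_mono mu mid _ _).1; rewrite ?scale_le// mulr_gt0// ltr0n.
Qed.

Lemma fisher_decreasing m n : (0 < m)%N -> (m <= n)%N -> (Psi n <= Psi m)%E.
Proof.
move=> m0 mn; have n0 := leq_trans m0 mn; rewrite !fisherE//.
apply: ge0_le_integral => //.
- by move=> t _; rewrite lee_fin sqr_ge0.
- exact: measurable_h.
- exact: measurable_h.
- move=> t; rewrite /= in_itv/= andbT => t0.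
  by rewrite lee_fin lerXn2r ?nnegrE ?(ltW (h_gt0 _ _))// h_le.
Qed.

Let se_cst (r t : R) : 0 < t -> {ae mu, forall x, x ^+ 2 = r} -> se t = r.
Proof.
move=> t0 mur; rewrite /self_energy (@stieltjes_ae_cst _ _ _ mu id mid r t t0 mur).
by rewrite invrK addrK.
Qed.

Lemma fisher_two_point m n (a : R) : (0 < m)%N -> (m <= n)%N ->
  has_law tau (X 0%N) (two_point a) -> Psi n = Psi m.
Proof.
move=> m0 mn la; have n0 := leq_trans m0 mn.
have inta k : (two_point a).-integrable setT (fun x : measurableTypeR R => (x ^+ k)%:E).
  exact: (la k).1.
pose E := @moment_functional _ (measurableTypeR R) R mu id intmu.
(* [mu] and the two-point law are known to share moments only. The nonnegative polynomial [q] has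
   integral zero under the latter, hence under [mu], which forces [x^2 = a^2] almost surely. *)
pose q : {poly R} := ('X^2 - (a ^+ 2)%:P) ^+ 2.
have qE x : q.[x] = (x ^+ 2 - a ^+ 2) ^+ 2.
  by rewrite /q horner_exp hornerD hornerN hornerXn hornerC.
have moments k : \int[two_point a]_x (x ^+ k) = E 'X^k.
  apply: complexI; rewrite -(la k).2 (Xlaw 0%N k).2; congr (_%:C%C).
  by apply: eq_Rintegral => x _; rewrite hornerXn.
have := @Rintegral_horner _ (measurableTypeR R) R (two_point a) id inta E q moments.
rewrite (@Rintegral_ae_eq _ _ _ (two_point a) _ (cst 0)); last 3 first.
- by apply/measurable_EFinP; exact: (measurable_int _ (@integrable_horner _ (measurableTypeR R) R (two_point a) id inta q)).
- exact: measurable_cst.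
- by apply: ae_imply (two_point_sqr a) => x xa; rewrite qE xa subrr expr0n.
rewrite Rintegral_probability_cst => /esym Eq0.
have mua : {ae mu, forall x, x ^+ 2 = a ^+ 2}.
  have := Rintegral_ge0_eq0 (@integrable_horner _ (measurableTypeR R) R mu id intmu q) _ Eq0.
  move=> /(_ (fun x => _)) qq.
  apply: ae_imply (qq _) => [x|x]; last by rewrite qE sqr_ge0.
  by rewrite qE => /eqP; rewrite sqrf_eq0 subr_eq0 => /eqP.
rewrite !fisherE//; apply: eq_integral => t; rewrite inE/= in_itv/= andbT => t0.
by rewrite /h !(se_cst _ mua)// mulr_gt0// ltr0n.
Qed.

(** The strict inequality and the finiteness exclude the trivial equalities: equal indices, and two
    infinite values, which occur whenever [mu] has an atom at 0. Finiteness also permits the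
    subtraction of the two integrals. *)
Lemma fisher_eq_two_point m n : (0 < m)%N -> (m < n)%N ->
  (Psi m < +oo)%E -> Psi n = Psi m ->
  exists2 a : R, a != 0 & has_law tau (X 0%N) (two_point a).
Proof.
move=> m0 mn fin eqPsi; have n0 := ltn_trans m0 mn.
(* One common value suffices. Without any, the nonnegative difference of the squares, of integral
   zero, would vanish nowhere on the half-line, and the half-line would be negligible. *)
have [t t0 ht] : exists2 t : R, 0 < t & h n t = h m t.
  apply: contrapT => nt.
  pose D : set R := `]0%R, +oo[%classic.
  have intg k : (0 < k)%N -> (Psi k < +oo)%E ->
      leb.-integrable D (fun t => (h k t ^+ 2)%:E).
    move=> k0; rewrite fisherE// => fin_k; apply/integrableP; split.
      exact: measurable_h.
    under eq_integral do rewrite gee0_abs ?lee_fin ?sqr_ge0//.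
    exact: fin_k.
  have ig_m := intg m m0 fin; have ig_n : leb.-integrable D (fun t => (h n t ^+ 2)%:E).
    by apply: intg => //; rewrite eqPsi.
  have diff_ge0 t : D t -> (0 <= (h m t ^+ 2)%:E - (h n t ^+ 2)%:E)%E.
    rewrite /D/= in_itv/= andbT => t0; rewrite -EFinB lee_fin subr_ge0.
    by rewrite lerXn2r ?nnegrE ?(ltW (h_gt0 _ _))// h_le// ltnW.
  have : (\int[leb]_(t in D) `|(h m t ^+ 2)%:E - (h n t ^+ 2)%:E| = 0)%E.
    under eq_integral => t tD do rewrite (gee0_abs (diff_ge0 t (set_mem tD))).
    have := eqPsi; rewrite !fisherE// => eqI.
    rewrite integralB//; last exact: measurable_itv.
    rewrite eqI subee//; apply: integrable_fin_num => //.
    exact: measurable_itv.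
  have md : measurable_fun D (fun t => (h m t ^+ 2)%:E - (h n t ^+ 2)%:E)%E.
    by apply: emeasurable_funB; exact: measurable_h.
  move=> /(ae_eq_integral_abs leb (measurable_itv _) md).1 aeD.
  have : leb.-negligible D.
    apply: negligibleS aeD => t Dt /= /(_ Dt) /eqP.
    rewrite -EFinB eqe subr_eq0 eqrXn2 ?(ltW (h_gt0 _ _))//; last 2 first.
    - by move: Dt; rewrite /D/= in_itv/= andbT.
    - by move: Dt; rewrite /D/= in_itv/= andbT.
    move=> /eqP ht; apply: nt; exists t => //.
    by move: Dt; rewrite /D/= in_itv/= andbT.
  move=> /negligibleP -/(_ (measurable_itv _)) D0.
  by have := lebesgue_measure_itv (`]0%R, +oo[ : interval R); rewrite [LHS]D0/= ltry.
have mt0 : 0 < m%:R * t by rewrite mulr_gt0// ltr0n.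
have nt0 : 0 < n%:R * t by rewrite mulr_gt0// ltr0n.
have mtnt : m%:R * t < n%:R * t by rewrite ltr_pM2r// ltr_nat.
have [_ /(_ mtnt)] := self_energy_mono mu mid mt0 (ltW mtnt).
have se_eq : se (m%:R * t) = se (n%:R * t) by apply/(addrI t)/invr_inj.
move=> /(_ se_eq); set r := se (n%:R * t) => mur.
have r0 : 0 <= r by exact: self_energy_ge0.
(* For [r = 0] the law is concentrated at 0 and [h m t = 1 / t], whose square is not integrable near
   0. *)
have rn0 : r != 0.
  apply/eqP => r00; move: fin; rewrite fisherE//.
  have -> : (\int[leb]_(t in `]0%R, +oo[) (h m t ^+ 2)%:E = +oo)%E.
    rewrite -(integral_resolvent0 (lexx (0 : R))).
    apply: eq_integral => u; rewrite inE/= in_itv/= andbT => u0.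
    by rewrite /h (se_cst _ mur) ?mulr_gt0 ?ltr0n// r00 addr0 add0r expr2.
  by rewrite ltxx.
exists (Num.sqrt r); first by rewrite sqrtr_eq0 -ltNge lt_neqAle eq_sym rn0.
move=> k; have [h1 h2] := symmetric_sqr_moment k musym mur.
have two_r : {ae two_point (Num.sqrt r), forall x, x ^+ 2 = r}.
  by have := two_point_sqr (Num.sqrt r); rewrite sqr_sqrtr.
have [h3 h4] := symmetric_sqr_moment k (two_point_symmetric (Num.sqrt r)) two_r.
by split => //; rewrite (Xlaw 0%N k).2 h2 h4.
Qed.

End BooleanSums.

Theorem theorem1p6 (R : realType) (H : completeNormedModType R[i]%C)
  (dot : {dot H for Num.conj}) (M : set (H -> H)) (tau : (H -> H) -> R[i]%C)
  (X : nat -> H -> H) (mu : probability (measurableTypeR R) R)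
  (HM : nc_probability_space dot M tau)
  (XM : forall i, M (X i)) (Xsa : forall i, selfadjoint dot (X i))
  (Xind : boolean_independent tau X)
  (Xlaw : forall i, has_law tau (X i) mu) (musym : symmetric_law mu) :
  let S n : H -> H := ((Num.sqrt (n%:R : R))^-1)%:C%C *: \sum_(i < n) X i in
  let Psi := boolean_fisher_information tau in
  forall n m : nat, (1 <= m)%N -> (m <= n)%N ->
    [/\ (Psi (S n) <= Psi (S m))%E,
        (exists2 a : R, a != 0 & has_law tau (X 0%N) (two_point a)) ->
          Psi (S n) = Psi (S m)
      & (m < n)%N -> (Psi (S m) < +oo)%E -> Psi (S n) = Psi (S m) ->
          exists2 a : R, a != 0 & has_law tau (X 0%N) (two_point a)].
Proof.
move=> S Psi n m m0 mn; split.
- exact: (fisher_decreasing HM XM Xsa Xind Xlaw musym).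
- move=> [a _]; exact: (fisher_two_point HM XM Xsa Xind Xlaw musym).
- exact: (fisher_eq_two_point HM XM Xsa Xind Xlaw musym).
Qed.
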